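(* Let $\mathring h(r)=r$ and let $M=(0,+\infty)\times N$ carry the metrics $g_0=dr^2+r^2\hat G$ and $g=dr^2+G(r)$ described in the context. If the limits $\mathcal M(0)$ and $\mathcal M(+\infty)$ of the relative radial mass $\mathcal M(r)$ at $0$ and $+\infty$ exist (as real numbers) and $r^{2}R_{rr}\in L^1(M,dr\,d\mu_{\hat{G}})$, then $$\mathcal M(+\infty)-\mathcal M(0)\ \geq\ \int_M r^{2}R_{rr}\,dr\,d\mu_{\hat{G}},$$ with equality if and only if $g$ is a warped product in the sense that $G(r)=r^2\widetilde{G}$ for some fixed (independent of $r$) Riemannian metric $\widetilde{G}$ on $N$. Moreover, if $g$ is asymptotic to $g_0$ at some $r_0\in[0,+\infty]$, then equality occurs if and only if $g=g_0$.
   Context: Let $n\geq 2$, let $N$ be a compact $(n-1)$-dimensional smooth manifold (with or without boundary), and let $r$ be the coordinate on the interval factor of $M$. All objects are assumed $C^\infty$. $\hat{G}$ is a fixed Riemannian metric on $N$, with Riemannian measure $\mu_{\hat G}$; $\mathring G(r)=\mathring h^2(r)\hat G$; and $G(r)$ is a family of Riemannian metrics on $N$, so that $g=dr^2+G(r)$ is a Riemannian metric on $M$. Let $H$ and $\mathring H$ be the mean curvatures (traces of the Weingarten maps with respect to $\partial_r$) of $N(r)=\{r\}\times N$ relative to $g$ and $g_0$: $H=\frac12\operatorname{Tr}(G^{-1}\partial_rG)$ and $\mathring H=(n-1)\mathring h'/\mathring h$. The relative radial mass is $\mathcal M(r)=\int_N \mathring{h}^{2}(\mathring{H}-H)\,d\mu_{\hat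 G}$. $R_{rr}$ denotes the Ricci curvature of $g$ in the $(\partial_r,\partial_r)$ direction. $g$ is said to be asymptotic to $g_0$ at a point $r_0$ of the closure (in $[-\infty,+\infty]$) of the interval if $\|G-\mathring G\|_{\mathring G}=o(1)$ as $r\to r_0$, uniformly on $N$ (pointwise norm of tensors on $N$ with respect to $\mathring G(r)$); for $r_0$ in the open interval this means that the two metrics coincide on $N(r_0)$. *)

(* Defs.v *)
From HB Require Import structures.
From mathcomp Require Import all_boot all_order all_algebra.
From mathcomp Require Import all_classical all_reals all_analysis.
Set Implicit Arguments.
Unset Strict Implicit.
Unset Printing Implicit Defensive.
Import Order.TTheory GRing.Theory Num.Theory.
Import numFieldNormedType.Exports.
Local Open Scope classical_set_scope.
Local Open Scope ring_scope.

Section Euclidean.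
Context {R : realType}.

Definition basis_vec {d : nat} (k : 'I_d) : 'rV[R]_d := delta_mx 0 k.

Fixpoint Ck_on {d : nat} (k : nat) (U : set 'rV[R]_d) (f : 'rV[R]_d -> R) :
    Prop :=
  (forall x, U x -> {for x, continuous f}) /\
  match k with
  | 0 => True
  | k'.+1 => forall i : 'I_d,
      (forall x, U x -> derivable f x (basis_vec i)) /\
      Ck_on k' U (fun x => 'D_(basis_vec i) f x)
  end.

(* Smoothness on an arbitrary subset D: locally the restriction to D of a
   C^oo function on an open set. This is the usual notion on relatively open
   subsets of a half-space. *)
Definition smooth_on {d : nat} (D : set 'rV[R]_d) (f : 'rV[R]_d -> R) : Prop :=
  forall x, D x -> exists (U : set 'rV[R]_d) (F : 'rV[R]_d -> R),
    [/\ open U, U x, (forall k, Ck_on k U F)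
      & forall y, U y -> D y -> F y = f y].

(* k-th partial derivative with increments kept inside D, hence one-sided
   where the k-th coordinate line leaves D, as at boundary points of a
   half-space. *)
Definition partial_in {d : nat} (D : set 'rV[R]_d) (k : 'I_d)
    (f : 'rV[R]_d -> R) (x : 'rV[R]_d) : R :=
  lim (h^-1 * (f (x + h *: basis_vec k) - f x)
    @[h --> within [set h : R | D (x + h *: basis_vec k)] 0^']).

Definition half_space (m : nat) : set 'rV[R]_m :=
  [set x | forall k : 'I_m, k = 0%N :> nat -> 0 <= x 0 k].

(* Iterated one-dimensional Lebesgue integrals; by Tonelli this is the integral
   against Lebesgue measure of R^m for nonnegative Borel functions, the only
   ones it is used for. *)
Fixpoint iterated_integral (m : nat) : ('rV[R]_m -> \bar R) -> \bar R :=
  match m return ('rV[R]_m -> \bar R) -> \bar R with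
  | 0 => fun f => f 0
  | m'.+1 => fun f => (\int[lebesgue_measure]_t
      iterated_integral (fun x : 'rV[R]_m' => f (row_mx (t%:M : 'rV_1) x)))%E
  end.

Definition christoffel {d : nat} (D : set 'rV[R]_d) (g : 'rV[R]_d -> 'M[R]_d)
    (k i j : 'I_d) (x : 'rV[R]_d) : R :=
  2^-1 * \sum_(l < d) invmx (g x) k l *
    (partial_in D i (fun y => g y j l) x + partial_in D j (fun y => g y i l) x
     - partial_in D l (fun y => g y i j) x).

(* Sign convention: positive on round spheres. *)
Definition ricci {d : nat} (D : set 'rV[R]_d) (g : 'rV[R]_d -> 'M[R]_d)
    (i j : 'I_d) (x : 'rV[R]_d) : R :=
  \sum_(k < d)
    (partial_in D k (christoffel D g k i j) x
     - partial_in D j (christoffel D g k i k) x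
     + \sum_(l < d) (christoffel D g k k l x * christoffel D g l i j x
                     - christoffel D g k j l x * christoffel D g l i k x)).

End Euclidean.

Arguments half_space {R} m _ : rename.

Section Manifold.
Context {R : realType}.

Record chart (m : nat) (N : topologicalType) := Chart {
  cdom : set N ;
  cfun :> N -> 'rV[R]_m ;
  cinv : 'rV[R]_m -> N ;
  cdom_open : open cdom ;
  cimage_open : exists O : set 'rV[R]_m,
    open O /\ cfun @` cdom = O `&` half_space m ;
  cfunK : forall p, cdom p -> cinv (cfun p) = p ;
  cfun_continuous : {within cdom, continuous cfun} ;
  cinv_continuous : {within cfun @` cdom, continuous cinv} }.

(* Charts take values in a half-space, so the boundary may be empty or not. *)
Record smooth_atlas (m : nat) (N : topologicalType) := SmoothAtlas {
  cidx : Type ;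
  charts :> cidx -> chart m N ;
  charts_cover : forall p, exists i, cdom (charts i) p ;
  charts_smooth : forall i j (k : 'I_m),
    smooth_on (charts i @` (cdom (charts i) `&` cdom (charts j)))
      (fun x => charts j (cinv (charts i) x) 0 k) }.

End Manifold.

Notation borel N := (g_sigma_algebraType (@open N)).

Section Metrics.
Context {R : realType} {m : nat} {N : ptopologicalType}.
Variable A : @smooth_atlas R m N.

Definition chart_at (p : N) : cidx A := projT1 (cid (charts_cover A p)).

(* A covariant 2-tensor on N, given by the matrix of its components at p in
   each chart i; only the values with p in the domain of i are meaningful. *)
Definition tensor2 := cidx A -> N -> 'M[R]_m.

Definition tensor2_eq (S T : tensor2) : Prop :=
  forall i p, cdom (A i) p -> S i p = T i p.

(* Jacobian matrix at p of the transition map from chart i to chart j. *)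
Definition jacobian_chart (i j : cidx A) (p : N) : 'M[R]_m :=
  \matrix_(k, l) partial_in (A i @` (cdom (A i) `&` cdom (A j))) l
    (fun x => A j (cinv (A i) x) 0 k) (A i p).

Definition riemannian_metric (T : tensor2) : Prop :=
  [/\ (forall i a b, smooth_on (A i @` cdom (A i))
          (fun x => T i (cinv (A i) x) a b)),
      (forall i j p, cdom (A i) p -> cdom (A j) p ->
          T i p = (jacobian_chart i j p)^T *m T j p *m jacobian_chart i j p),
      (forall i p, cdom (A i) p -> (T i p)^T = T i p)
    & (forall i p, cdom (A i) p -> forall v : 'rV[R]_m, v != 0 ->
          0 < (v *m T i p *m v^T) 0 0)].

(* This determines mu, as the charts cover N. *)
Definition riemannian_measure (T : tensor2) (mu : set (borel N) -> \bar R) :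
    Prop :=
  forall i (B : set (borel N)), measurable B -> B `<=` cdom (A i) ->
    mu B = iterated_integral (fun x : 'rV[R]_m =>
      (\1_(A i @` B) x * Num.sqrt (\det (T i (cinv (A i) x))))%:E).

(* Pointwise norm of T with respect to g:
   |T|^2 = g^{ac} g^{be} T_{ab} T_{ce}. *)
Definition tensor2_norm (g T : tensor2) (p : N) : R :=
  let gi := invmx (g (chart_at p) p) in
  let t := T (chart_at p) p in
  Num.sqrt (\tr (gi *m t *m gi *m t^T)).

(* A family G(r), r > 0, encodes the metric dr^2 + G(r) on (0, +oo) x N; in the
   chart i of N the coordinates on this product are (r, x) in R^(1 + m). *)
Definition cylinder_dom (i : cidx A) : set 'rV[R]_(1 + m) :=
  [set y | 0 < lsubmx y 0 0 /\ (A i @` cdom (A i)) (rsubmx y)].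

Definition cylinder_metric (G : R -> tensor2) (i : cidx A)
    (y : 'rV[R]_(1 + m)) : 'M[R]_(1 + m) :=
  block_mx 1%:M 0 0 (G (lsubmx y 0 0) i (cinv (A i) (rsubmx y))).

Definition riemannian_cylinder (G : R -> tensor2) : Prop :=
  (forall r, 0 < r -> riemannian_metric (G r)) /\
  (forall i a b, smooth_on (cylinder_dom i)
     (fun y => cylinder_metric G i y a b)).

Definition ricci_rr (G : R -> tensor2) (r : R) (p : N) : R :=
  let i := chart_at p in
  ricci (cylinder_dom i) (cylinder_metric G i) ord0 ord0
    (row_mx (r%:M : 'rV_1) (A i p)).

Definition mean_curvature (G : R -> tensor2) (r : R) (p : N) : R :=
  let i := chart_at p in
  2^-1 * \tr (invmx (G r i p) *m
              \matrix_(a, b) derive1 (fun s : R => G s i p a b) r).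

Definition warped (h : R -> R) (Ghat : tensor2) (r : R) : tensor2 :=
  fun i p => h r ^+ 2 *: Ghat i p.

Definition warped_mean_curvature (h : R -> R) (r : R) : R :=
  m%:R * derive1 h r / h r.

Definition relative_radial_mass (h : R -> R)
    (mu : {measure set (borel N) -> \bar R}) (G : R -> tensor2) (r : R) : R :=
  (\int[mu]_(p in [set: borel N])
     (h r ^+ 2 * (warped_mean_curvature h r - mean_curvature G r p)))%R.

(* The smallness is required at r0 itself when r0 lies in the open interval. *)
Definition asymptotic_at (h : R -> R) (Ghat : tensor2) (G : R -> tensor2)
    (r0 : \bar R) : Prop :=
  forall e : R, 0 < e ->
    \forall x \near nbhs r0, forall r : R, 0 < r -> x = r%:E -> forall p : N,
      tensor2_norm (warped h Ghat r)
        (fun i q => G r i q - warped h Ghat r i q) p < e.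

End Metrics.

(* Main.v *)
Require Import Defs.
From mathcomp Require Import all_boot all_order all_algebra.
From mathcomp Require Import all_classical all_reals all_analysis.
From mathcomp Require Import measurable_realfun ring lra.
Set Implicit Arguments.
Unset Strict Implicit.
Unset Printing Implicit Defensive.
Import Order.TTheory GRing.Theory Num.Theory.
Import numFieldNormedType.Exports.
Local Open Scope classical_set_scope.
Local Open Scope ring_scope.

(** Why the theorem holds.  Let [m] be the dimension of [N], let
    [W = G^-1 G' / 2] be the Weingarten map of the slices and [H] its trace.  In
    the metric [dr^2 + G(r)], with 0 the radial index, the Christoffel symbols
    [Gamma^k_00] vanish and the [Gamma^k_0j] are the entries of [W] bordered by
    zeros ([christoffel00], [christoffel0]), so the radial Ricci curvature is
    given by the Riccati equation [R_rr = - H' - tr (W^2)] ([ricci_rrE]).  The integrand of the mass is the flux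
    [F = m r - r^2 H], and completing the square gives
[[
      F' = r^2 R_rr + tr ((r W - 1)^2)
]]
    ([derive_flux]).  As [W] is self-adjoint for [G], the last term is the
    squared norm of [r W - 1]: it is nonnegative, and it vanishes only if
    [W = 1 / r] ([posdefmx_trace_ge0], [posdefmx_trace_eq0], through a basis
    orthonormal for [G]).

    Integrating over [a <= r <= b] and then over [N] gives
    [M(b) - M(a) = (integral of r^2 R_rr) + (total defect from a to b)]
    ([mass_increment]).  Fubini's theorem is applied to the Ricci term; the
    defect term is integrable over [N] because the other three terms are.  The
    total defect is nonnegative and grows with the interval.  Letting [a] tend
    to 0 and [b] to infinity proves the inequality ([mass_inequality]).

    Equality makes every total defect vanish.  The squared defect is continuous
    in [(r, p)] and nonempty open subsets of [N] have positive measure, hence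
    [r W = 1] everywhere ([mass_equality]).  This says that [G(r) / r^2] has
    zero derivative, i.e. [G(r) = r^2 G(1)] ([cone_of_cone_defect_eq0]); the
    converse is a direct computation ([cone_defect_eq0_of_cone]).  Finally the
    norm [|r^2 G(1) - r^2 Ghat|] taken with respect to [r^2 Ghat] is independent
    of [r], so if it becomes arbitrarily small anywhere then [G(1) = Ghat]
    ([cone_asymptotic]).

    Scalars such as [H] are defined at each point in one chosen chart.  They are
    independent of the chart because transition maps do not involve [r], so that
    [G] and [G'] transform by the same Jacobians; this is what makes them
    continuous on [N].  Compactness enters through the finiteness of the measure
    ([riemannian_measure_finite]), which makes the flux integrable. *)

(** * Positive definite matrices *)

Definition posdefmx (R : realType) (m : nat) (S : 'M[R]_m) : Prop :=
  S^T = S /\ forall v : 'rV[R]_m, v != 0 -> 0 < (v *m S *m v^T) 0 0.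

Lemma posdefmx_unit (R : realType) (m : nat) (S : 'M[R]_m) :
  posdefmx S -> S \in unitmx.
Proof.
case=> _ Spos; rewrite -row_free_unit -kermx_eq0; apply/negP => /negP.
move=> /rowV0Pn [v /sub_kermxP vS v0].
by have := Spos v v0; rewrite vS mul0mx mxE ltxx.
Qed.

Lemma posdefmx_congr (R : realType) (m n : nat) (S : 'M[R]_m)
    (L : 'M[R]_(n, m)) :
  row_free L -> posdefmx S -> posdefmx (L *m S *m L^T).
Proof.
move=> Lfree [Ssym Spos]; split; first by rewrite !trmx_mul trmxK Ssym mulmxA.
move=> v v0; have : v *m L != 0.
  by rewrite -[X in _ != X](mul0mx _ L) (inj_eq (row_free_inj Lfree)).
by move=> /Spos; rewrite trmx_mul !mulmxA.
Qed.

(** Cholesky decomposition: induction on the size, eliminating with a pivot that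
    is positive because [S] is. *)
Lemma posdefmx_orthonormal (R : realType) (m : nat) (S : 'M[R]_m) :
  posdefmx S -> exists P : 'M[R]_m, P \in unitmx /\ P *m S *m P^T = 1%:M.
Proof.
elim: m S => [|m IH] S Spd.
  by exists 1%:M; split; rewrite ?unitmx1//; apply/matrixP => -[].
rewrite -[m.+1]/(1 + m)%N in S Spd *.
set a := S 0 0; set b := ursubmx S; set D := drsubmx S.
have a0 : 0 < a.
  have /Spd.2 : delta_mx 0 0 != 0 :> 'rV[R]_(1 + m).
    by apply/eqP => /rowP /(_ 0); rewrite !mxE !eqxx => /eqP; rewrite oner_eq0.
  by rewrite -rowE trmx_delta -colE !mxE.
have aN0 : a != 0 by rewrite gt_eqF.
have ulE : ulsubmx S = a%:M.
  apply/matrixP => i j; rewrite !ord1 !mxE eqxx mulr1n /a.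
  by congr (S _ _); apply/val_inj.
have dlE : dlsubmx S = b^T by rewrite /b trmx_ursub Spd.1.
have SE : S = block_mx a%:M b b^T D by rewrite -ulE -dlE submxK.
pose L : 'M[R]_(1 + m) := block_mx 1%:M 0 (- (a^-1 *: b^T)) 1%:M.
have Lu : L \in unitmx by rewrite unitmxE det_lblock !det1 mulr1 unitr1.
pose D' := D - a^-1 *: (b^T *m b).
(* one step of Gaussian elimination: the Schur complement of the pivot a *)
have LS : L *m S *m L^T = block_mx a%:M 0 0 D'.
  rewrite /L SE tr_block_mx !mulmx_block !mul1mx !mul0mx !trmx1 !trmx0 !addr0.
  rewrite linearN linearZ /= trmxK !mulmx0 !mulmx1 !addr0.
  have e1 : - (a^-1 *: b^T) *m a%:M + b^T = 0.
    by rewrite mulNmx -scalemxAl mul_mx_scalar scalerA mulVf// scale1r addNr.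
  rewrite e1 mul0mx add0r; congr block_mx.
    by rewrite mulmxN -scalemxAr mul_scalar_mx scalerA mulVf// scale1r addNr.
  by rewrite mulNmx -scalemxAl addrC.
have D'pd : posdefmx D'.
  have := @posdefmx_congr R _ m _ (row_mx 0 1%:M) _
    (posdefmx_congr _ Spd : posdefmx (L *m S *m L^T)).
  rewrite LS mul_row_block !mul0mx !mul1mx !add0r tr_row_mx mul_row_col.
  rewrite trmx0 trmx1 mulmx0 mulmx1 add0r; apply.
    by rewrite /row_free rank_row_0mx mxrank1.
  by rewrite row_free_unit.
have [P [Pu PD]] := IH D' D'pd.
pose s := (Num.sqrt a)^-1.
have s0 : s != 0 by rewrite invr_eq0 gt_eqF// sqrtr_gt0.
have sa : s * a * s = 1.
  by rewrite mulrAC -expr2 exprVn sqr_sqrtr ?ltW// mulVf.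
exists (block_mx s%:M 0 0 P *m L); split.
  rewrite unitmx_mul Lu andbT unitmxE det_lblock unitrM -!unitmxE Pu andbT.
  by rewrite unitmxE det_scalar expr1 unitfE.
rewrite trmx_mul mulmxA -(mulmxA _ L S) -(mulmxA _ (L *m S)) LS.
rewrite tr_block_mx !mulmx_block !(mulmx0, mul0mx, addr0, add0r, trmx0).
by rewrite tr_scalar_mx PD -!scalar_mxM sa -scalar_mx_block.
Qed.

(** In a basis orthonormal for [S] the trace becomes the squared Frobenius norm
    of a symmetric matrix. *)
Lemma posdefmx_trace (R : realType) (m : nat) (S T : 'M[R]_m) :
  posdefmx S -> T^T = T ->
  exists2 P : 'M[R]_m, P \in unitmx &
    \tr (invmx S *m T *m invmx S *m T) = \sum_i \sum_j (P *m T *m P^T) i j ^+ 2.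
Proof.
move=> Spd Tsym; have [P [Pu PS]] := posdefmx_orthonormal Spd.
exists P => //; set C := P *m T *m P^T.
have Csym : C^T = C by rewrite /C !trmx_mul trmxK Tsym mulmxA.
have SE : invmx S = P^T *m P.
  have Su := posdefmx_unit Spd.
  apply: (can_inj (mulmxK Su)); rewrite mulVmx//.
  have PSE : P *m S = invmx P^T.
    by apply: (can_inj (mulmxK (_ : P^T \in unitmx)));
      rewrite ?PS ?mulVmx ?unitmx_tr.
  by rewrite -mulmxA PSE mulmxV// unitmx_tr.
transitivity (\tr (C *m C)).
  by rewrite SE -!mulmxA mxtrace_mulC /C !mulmxA.
rewrite -[X in \tr (_ *m X)]Csym /mxtrace.
apply: eq_bigr => i _; rewrite [LHS]mxE.
by apply: eq_bigr => j _; rewrite [C^T _ _]mxE expr2.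
Qed.

Lemma posdefmx_trace_ge0 (R : realType) (m : nat) (S T : 'M[R]_m) :
  posdefmx S -> T^T = T -> 0 <= \tr (invmx S *m T *m invmx S *m T).
Proof.
move=> Spd Tsym; have [P _ ->] := posdefmx_trace Spd Tsym.
by apply: sumr_ge0 => i _; apply: sumr_ge0 => j _; rewrite sqr_ge0.
Qed.

Lemma posdefmx_trace_eq0 (R : realType) (m : nat) (S T : 'M[R]_m) :
  posdefmx S -> T^T = T -> \tr (invmx S *m T *m invmx S *m T) = 0 -> T = 0.
Proof.
move=> Spd Tsym; have [P Pu ->] := posdefmx_trace Spd Tsym => /eqP.
rewrite psumr_eq0 => [/allP H|i _]; last first.
  by apply: sumr_ge0 => j _; rewrite sqr_ge0.
have C0 : P *m T *m P^T = 0.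
  apply/matrixP => i j; have := H i (mem_index_enum _).
  rewrite /= psumr_eq0 => [/allP/(_ j (mem_index_enum _))|k _]; last first.
    by rewrite sqr_ge0.
  by rewrite /= sqrf_eq0 => /eqP ->; rewrite mxE.
apply: (can_inj (mulKmx Pu)); apply: (can_inj (mulmxK (_ : P^T \in unitmx))).
  by rewrite unitmx_tr.
by rewrite C0 mulmx0 mul0mx.
Qed.

Lemma congr_unitmx (R : realType) (m : nat) (S J : 'M[R]_m) :
  J^T *m S *m J \in unitmx -> S \in unitmx /\ J \in unitmx.
Proof. by rewrite !unitmx_mul unitmx_tr => /andP[/andP[]]. Qed.

Lemma invmx_congr (R : realType) (m : nat) (S J T : 'M[R]_m) :
  J^T *m S *m J \in unitmx ->
  invmx (J^T *m S *m J) *m (J^T *m T *m J) = invmx J *m (invmx S *m T) *m J.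
Proof.
move=> U; have [Su Ju] := congr_unitmx U; apply: (can_inj (mulKmx U)).
rewrite mulKVmx// -!mulmxA; congr (_ *m _); rewrite (mulKVmx Ju).
by rewrite (mulKVmx Su).
Qed.

Lemma mxtrace_conj (R : realType) (m : nat) (J B : 'M[R]_m) :
  J \in unitmx -> \tr (invmx J *m B *m J) = \tr B.
Proof. by move=> Ju; rewrite mxtrace_mulC mulmxA mulmxV// mul1mx. Qed.

(** With [J] the Jacobian of a transition map, this and the next lemma make
    scalars built from a metric and a second tensor independent of the chart. *)
Lemma mxtrace_congr (R : realType) (m : nat) (S J T : 'M[R]_m) :
  J^T *m S *m J \in unitmx ->
  \tr (invmx (J^T *m S *m J) *m (J^T *m T *m J)) = \tr (invmx S *m T).
Proof.
by move=> U; rewrite invmx_congr// mxtrace_conj//; case: (congr_unitmx U).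
Qed.

Lemma mxtrace2_congr (R : realType) (m : nat) (S J T : 'M[R]_m) :
  J^T *m S *m J \in unitmx ->
  \tr (invmx (J^T *m S *m J) *m (J^T *m T *m J) *m
       invmx (J^T *m S *m J) *m (J^T *m T *m J)) =
  \tr (invmx S *m T *m invmx S *m T).
Proof.
move=> U; rewrite -mulmxA invmx_congr//; have [Su Ju] := congr_unitmx U.
rewrite -!mulmxA (mulKVmx Ju) !mulmxA.
by rewrite -!mulmxA mxtrace_mulC !mulmxA mulmxK// !mulmxA.
Qed.

(** With [W] half of [S^-1 D], the left side is the trace of the square of
    [r W - 1]. *)
Lemma mxtrace_defect (R : realType) (m : nat) (S D : 'M[R]_m) (r : R) :
  S \in unitmx ->
  let W := 2^-1 *: (invmx S *m D) in
  let T := (r / 2) *: D - S in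
  \tr (invmx S *m T *m invmx S *m T) =
    r ^+ 2 * \tr (W *m W) - 2 * r * \tr W + m%:R.
Proof.
move=> Su W T; have -> : invmx S *m T = r *: W - 1%:M.
  by rewrite mulmxBr mulVmx// /W scalerA -scalemxAr.
rewrite -mulmxA; have -> : invmx S *m T = r *: W - 1%:M.
  by rewrite mulmxBr mulVmx// /W scalerA -scalemxAr.
clearbody W; rewrite mulmxBr mulmx1 mulmxBl mul1mx -scalemxAl -scalemxAr.
rewrite scalerA.
have trB (X Y : 'M[R]_m) : \tr (X - Y) = \tr X - \tr Y by exact: raddfB.
by rewrite !trB !mxtraceZ mxtrace1; ring.
Qed.

(** * Function algebras closed under matrix inversion *)

(** Continuity on an open set and continuous differentiability both have these
    closure properties, which is all that is needed to pass from the entries of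
    a matrix to those of its inverse by Cramer's rule. *)
Record function_algebra (R : realType) (T : Type) (D : set T)
    (C : (T -> R) -> Prop) : Prop := FunctionAlgebra {
  fa_cst : forall c, C (fun=> c) ;
  fa_add : forall f g, C f -> C g -> C (fun t => f t + g t) ;
  fa_mul : forall f g, C f -> C g -> C (fun t => f t * g t) ;
  fa_inv : forall f, C f -> (forall t, D t -> f t != 0) ->
    C (fun t => (f t)^-1) ;
  fa_ext : forall f g, (forall t, D t -> f t = g t) -> C f -> C g }.

Lemma fa_sum (R : realType) (T : Type) (D : set T) (C : (T -> R) -> Prop)
    (fa : function_algebra D C) (I : Type) (s : seq I) (P : pred I)
    (f : I -> T -> R) :
  (forall i, C (f i)) -> C (fun t => \sum_(i <- s | P i) f i t).
Proof.
move=> Cf; elim: s => [|i s IH].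
  by under eq_fun do rewrite big_nil; exact: (fa_cst fa _).
under eq_fun do rewrite big_cons; case: (P i) => //.
exact: (fa_add fa).
Qed.

Lemma fa_prod (R : realType) (T : Type) (D : set T) (C : (T -> R) -> Prop)
    (fa : function_algebra D C) (I : Type) (s : seq I) (P : pred I)
    (f : I -> T -> R) :
  (forall i, C (f i)) -> C (fun t => \prod_(i <- s | P i) f i t).
Proof.
move=> Cf; elim: s => [|i s IH].
  by under eq_fun do rewrite big_nil; exact: (fa_cst fa _).
under eq_fun do rewrite big_cons; case: (P i) => //.
exact: (fa_mul fa).
Qed.

Lemma fa_det (R : realType) (T : Type) (D : set T) (C : (T -> R) -> Prop)
    (fa : function_algebra D C) (m : nat) (S : T -> 'M[R]_m) :
  (forall a b, C (fun t => S t a b)) -> C (fun t => \det (S t)).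
Proof.
move=> CS; rewrite /determinant; apply: (fa_sum fa) => s.
apply: (fa_mul fa); first exact: (fa_cst fa _).
exact: (fa_prod fa).
Qed.

Lemma fa_mulmx (R : realType) (T : Type) (D : set T) (C : (T -> R) -> Prop)
    (fa : function_algebra D C) (m n p : nat)
    (S : T -> 'M[R]_(m, n)) (S' : T -> 'M[R]_(n, p)) :
  (forall a b, C (fun t => S t a b)) -> (forall a b, C (fun t => S' t a b)) ->
  forall a b, C (fun t => (S t *m S' t) a b).
Proof.
move=> CS CS' a b; under eq_fun do rewrite mxE.
by apply: (fa_sum fa) => c; exact: (fa_mul fa).
Qed.

Lemma fa_trace (R : realType) (T : Type) (D : set T) (C : (T -> R) -> Prop)
    (fa : function_algebra D C) (m : nat) (S : T -> 'M[R]_m) :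
  (forall a b, C (fun t => S t a b)) -> C (fun t => \tr (S t)).
Proof. by move=> CS; exact: (fa_sum fa). Qed.

Lemma fa_invmx (R : realType) (T : Type) (D : set T) (C : (T -> R) -> Prop)
    (fa : function_algebra D C) (m : nat) (S : T -> 'M[R]_m) :
  (forall t, D t -> S t \in unitmx) ->
  (forall a b, C (fun t => S t a b)) ->
  forall a b, C (fun t => invmx (S t) a b).
Proof.
move=> Su CS a b.
apply: (fa_ext fa (f := fun t => (\det (S t))^-1 * \adj (S t) a b)).
  by move=> t Dt; rewrite /invmx Su// [RHS]mxE.
apply: (fa_mul fa).
  apply: (fa_inv fa) => [|t Dt]; first exact: (fa_det fa).
  by have := Su t Dt; rewrite unitmxE unitfE.
under eq_fun do rewrite mxE /cofactor.
apply: (fa_mul fa); first exact: (fa_cst fa _).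
by apply: (fa_det fa) => c d; under eq_fun do rewrite !mxE.
Qed.

Lemma function_algebra_continuous (R : realType) (T : topologicalType)
    (D : set T) :
  open D ->
  function_algebra D (fun f : T -> R => forall t, D t -> {for t, continuous f}).
Proof.
move=> oD; split.
- by move=> c t _; exact: cst_continuous.
- by move=> f g Cf Cg t Dt; apply: continuousD; [exact: Cf|exact: Cg].
- by move=> f g Cf Cg t Dt; apply: continuousM; [exact: Cf|exact: Cg].
- by move=> f Cf f0 t Dt; apply: continuousV; [exact: f0|exact: Cf].
- move=> f g fg Cf t Dt.
  have nfg : \forall x \near t, f x = g x.
    by apply: filterS (open_nbhs_nbhs (conj oD Dt)) => x Dx; exact: fg.
  rewrite /prop_for /continuous_at -(fg t Dt).
  apply: cvg_trans (Cf t Dt); apply: near_eq_cvg.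
  exact: nfg.
Qed.

Definition C1_pos (R : realType) (f : R -> R) : Prop :=
  forall r, 0 < r -> derivable f r 1 /\ {for r, continuous (derive1 f)}.

Lemma nbhs_pos (R : realType) (r : R) : 0 < r -> \forall x \near r, 0 < x.
Proof. by move=> r0; exact: lt_nbhsr. Qed.

Lemma near_continuous (R : realType) (f g : R -> R) (r : R) :
  (\forall x \near r, f x = g x) -> {for r, continuous f} ->
  {for r, continuous g}.
Proof.
move=> fg cf; rewrite /prop_for /continuous_at -(nbhs_singleton fg).
apply: cvg_trans cf; apply: near_eq_cvg.
exact: fg.
Qed.

Lemma derivable1_continuous (R : realType) (f : R -> R) (r : R) :
  derivable f r 1 -> {for r, continuous f}.
Proof. by move/derivable1_diffP/differentiable_continuous. Qed.

Lemma function_algebra_C1_pos (R : realType) :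
  function_algebra [set r : R | 0 < r] (@C1_pos R).
Proof.
split.
- move=> c r _; split; first exact: derivable_cst.
  apply: (@near_continuous _ (fun=> 0)); last exact: cst_continuous.
  by near=> x; rewrite derive1_cst.
- move=> f g Cf Cg r r0; have [[df cf] [dg cg]] := (Cf r r0, Cg r r0).
  split; first exact: (derivableD df dg).
  apply: (@near_continuous _ (fun x => derive1 f x + derive1 g x)).
    near=> x; have x0 : 0 < x by near: x; exact: nbhs_pos.
    by rewrite !derive1E -(deriveD (Cf x x0).1 (Cg x x0).1).
  exact: (continuousD cf cg).
- move=> f g Cf Cg r r0; have [[df cf] [dg cg]] := (Cf r r0, Cg r r0).
  split; first exact: (derivableM df dg).
  apply: (@near_continuous _ (fun x => f x * derive1 g x + g x * derive1 f x)).
    near=> x; have x0 : 0 < x by near: x; exact: nbhs_pos.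
    rewrite !derive1E; transitivity ('D_1 (f * g) x) => //.
    by rewrite (deriveM (Cf x x0).1 (Cg x x0).1).
  apply: (continuousD (continuousM _ cg) (continuousM _ cf)).
    exact: (derivable1_continuous df).
  exact: (derivable1_continuous dg).
- move=> f Cf f0 r r0; have [df cf] := Cf r r0.
  split; first exact: (derivableV (f0 r r0) df).
  apply: (@near_continuous _ (fun x => - (f x * f x)^-1 * derive1 f x)).
    near=> x; have x0 : 0 < x by near: x; exact: nbhs_pos.
    rewrite !derive1E.
    by rewrite (deriveV (f0 x x0) (Cf x x0).1).
  have cf' := derivable1_continuous df.
  apply: (continuousM (continuousN (continuousV _ (continuousM cf' cf'))) cf).
  by rewrite mulf_neq0//; exact: f0.
- move=> f g fg Cf r r0; have [df cf] := Cf r r0.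
  have nfg : \forall y \near r, \forall x \near y, f x = g x.
    near=> y; near=> x; apply: fg; near: x; apply: nbhs_pos; near: y.
    exact: nbhs_pos.
  split; first exact: near_eq_derivable (nbhs_singleton nfg) df.
  apply: near_continuous cf; apply: filterS nfg => y yfg.
  by rewrite !derive1E; exact: near_eq_derive.
Unshelve. all: by end_near. Qed.

(** * Smooth families of functions on a manifold *)

Lemma row_mx_nbhs (R : realType) (m : nat) (T : topologicalType)
    (f : T -> 'rV[R]_m) (t : T) :
  (forall k, {for t, continuous (fun s => f s 0 k)}) -> {for t, continuous f}.
Proof.
move=> cf V [P fP PV]; near=> s; apply: PV => i j.
move: i j; near: s; apply: filter_forall => i; apply: filter_forall => j.
by rewrite [i]ord1; apply: cf; have := fP 0 j.
Unshelve. all: by end_near. Qed.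

Lemma continuous_entry (R : realType) (m : nat) (T : topologicalType)
    (f : T -> 'rV[R]_m) (t : T) (k : 'I_m) :
  {for t, continuous f} -> {for t, continuous (fun s => f s 0 k)}.
Proof.
move=> cf; apply: (continuous_comp (g := fun x : 'rV[R]_m => x 0 k)) => //.
exact: coord_continuous.
Qed.

Section SmoothFamily.
Context {R : realType} {m : nat} {N : ptopologicalType}.
Variable A : @smooth_atlas R m N.

(** Smoothness on the cylinder in coordinates, which differentiation in [r]
    preserves; it also gives joint continuity on [R * N]. *)
Definition smooth_family (i : cidx A) (f : R -> N -> R) : Prop :=
  smooth_on (cylinder_dom i)
    (fun y => f (lsubmx y 0 0) (cinv (A i) (rsubmx y))).

Definition cyl_pt (r : R) (x : 'rV[R]_m) : 'rV[R]_(1 + m) :=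
  row_mx (r%:M : 'rV_1) x.

Lemma lsub_cyl_pt r x : lsubmx (cyl_pt r x) 0 0 = r.
Proof. by rewrite row_mxKl mxE eqxx mulr1n. Qed.

Lemma rsub_cyl_pt r x : rsubmx (cyl_pt r x) = x.
Proof. by rewrite row_mxKr. Qed.

Lemma cyl_ptK (y : 'rV[R]_(1 + m)) : cyl_pt (lsubmx y 0 0) (rsubmx y) = y.
Proof.
rewrite -[RHS]hsubmxK /cyl_pt; congr row_mx.
by apply/matrixP => a b; rewrite !ord1 !mxE eqxx mulr1n.
Qed.

Lemma cyl_ptD (h r : R) (x : 'rV[R]_m) :
  h *: basis_vec ord0 + cyl_pt r x = cyl_pt (h + r) x.
Proof.
apply/rowP => k; rewrite /basis_vec !mxE; case: splitP => j jk.
  have -> : k = ord0 by apply/val_inj; rewrite /= jk ord1.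
  by rewrite !ord1 !mxE !eqxx /= !mulr1n mulr1.
have -> : (k == ord0) = false.
  by apply/eqP => /(congr1 val); rewrite /= jk.
by rewrite andbF mulr0 add0r.
Qed.

Lemma cylinder_domE i (r : R) p :
  0 < r -> cdom (A i) p -> cylinder_dom i (cyl_pt r (A i p)).
Proof.
by move=> r0 ip; split; rewrite ?lsub_cyl_pt// rsub_cyl_pt; exists p.
Qed.

Lemma cyl_pt_continuous_r (x : 'rV[R]_m) : continuous (fun r => cyl_pt r x).
Proof.
move=> r; apply: row_mx_nbhs => k; have [j ->|j ->] := split_ordP k.
  have -> : (fun s => cyl_pt s x 0 (lshift m j)) = id.
    by apply/funext => s; rewrite row_mxEl mxE ord1 eqxx mulr1n.
  exact: cvg_id.

have -> : (fun s => cyl_pt s x 0 (rshift 1 j)) = (fun=> x 0 j).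
  by apply/funext => s; rewrite row_mxEr.
exact: cst_continuous.
Qed.

Lemma chart_continuous i p :
  cdom (A i) p -> {for p, continuous (A i : N -> 'rV[R]_m)}.
Proof.
move=> ip; have := @cfun_continuous _ _ _ (A i).
rewrite continuous_open_subspace; last exact: cdom_open.
by apply; rewrite inE.
Qed.

Lemma cyl_pt_chart_continuous i (z : R * N) :
  cdom (A i) z.2 ->
  {for z, continuous (fun z : R * N => cyl_pt z.1 (A i z.2))}.
Proof.
move=> ip; apply: row_mx_nbhs => k; have [j ->|j ->] := split_ordP k.
  have -> : (fun z : R * N => cyl_pt z.1 (A i z.2) 0 (lshift m j)) = fst.
    by apply/funext => s; rewrite row_mxEl mxE ord1 eqxx mulr1n.
  exact: cvg_fst.
have -> : (fun z : R * N => cyl_pt z.1 (A i z.2) 0 (rshift 1 j)) =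
    (fun z => A i z.2 0 j).
  by apply/funext => s; rewrite row_mxEr.
apply: (continuous_comp (f := snd) (g := fun p => A i p 0 j)).
  exact: cvg_snd.
by apply: continuous_entry; exact: chart_continuous.
Qed.

(** The coordinate in the chart determines the point, so a local smooth
    extension in the chart is an expression for the family itself. *)
Lemma smooth_family_local i f r p :
  smooth_family i f -> 0 < r -> cdom (A i) p ->
  exists (U : set 'rV[R]_(1 + m)) (F : 'rV[R]_(1 + m) -> R),
    [/\ open U, U (cyl_pt r (A i p)), (forall k, Ck_on k U F) &
      forall s q, 0 < s -> cdom (A i) q -> U (cyl_pt s (A i q)) ->
        F (cyl_pt s (A i q)) = f s q].
Proof.
move=> sf r0 ip; have [U [F [oU Uy CF EF]]] := sf _ (cylinder_domE r0 ip).
exists U, F; split => // s q s0 iq Us; rewrite EF//; last exact: cylinder_domE.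
by rewrite lsub_cyl_pt rsub_cyl_pt cfunK.
Qed.

Definition cyl_open (i : cidx A) : set (R * N) :=
  [set z | 0 < z.1 /\ cdom (A i) z.2].

Lemma open_cyl_open i : open (cyl_open i).
Proof.
apply: openI.
  apply: (@open_comp _ _ fst [set r : R | 0 < r]); last exact: open_gt.
  by move=> z _; exact: cvg_fst.
apply: (@open_comp _ _ snd (cdom (A i))); last exact: cdom_open.
by move=> z _; exact: cvg_snd.
Qed.

Lemma smooth_family_continuous i f :
  smooth_family i f ->
  forall z, cyl_open i z -> {for z, continuous (fun z => f z.1 z.2)}.
Proof.
move=> sf z [r0 ip]; have [U [F [oU Uy CF EF]]] := smooth_family_local sf r0 ip.
have cF : {for z, continuous (fun z => F (cyl_pt z.1 (A i z.2)))}.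
  apply: continuous_comp; first exact: cyl_pt_chart_continuous.
  exact: (CF 0%N).1.
rewrite /prop_for /continuous_at -EF//; apply: cvg_trans cF.
apply: near_eq_cvg.
have nz : nbhs z (cyl_open i).
  by apply: open_nbhs_nbhs; split; [exact: open_cyl_open|split].
have nU : nbhs z [set w | U (cyl_pt w.1 (A i w.2))].
  by apply: (@cyl_pt_chart_continuous i z ip U); exact: open_nbhs_nbhs.
by apply: filterS2 nz nU => w [w0 iw] Uw; rewrite EF.
Qed.

Lemma is_derive_cyl_pt (F : 'rV[R]_(1 + m) -> R) (r : R) x :
  derivable F (cyl_pt r x) (basis_vec ord0) ->
  is_derive r 1 (fun s => F (cyl_pt s x))
    ('D_(basis_vec ord0) F (cyl_pt r x)).
Proof.
rewrite /derivable => dF.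
have E : (fun h => h^-1 *: (((fun s => F (cyl_pt s x)) \o shift r) (h *: 1) -
    F (cyl_pt r x))) = (fun h => h^-1 *: ((F \o shift (cyl_pt r x))
    (h *: basis_vec ord0) - F (cyl_pt r x))).
  by apply/funext => h /=; rewrite cyl_ptD [h *: 1]mulr1.
by apply: DeriveDef; rewrite /derivable /derive E.
Qed.

Lemma smooth_family_is_derive i f r p U (F : 'rV[R]_(1 + m) -> R) :
  0 < r -> cdom (A i) p -> open U -> U (cyl_pt r (A i p)) ->
  (forall k, Ck_on k U F) ->
  (forall s q, 0 < s -> cdom (A i) q -> U (cyl_pt s (A i q)) ->
        F (cyl_pt s (A i q)) = f s q) ->
  is_derive r 1 (f^~ p) ('D_(basis_vec ord0) F (cyl_pt r (A i p))).
Proof.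
move=> r0 ip oU Uy CF EF.
apply: (@near_eq_is_derive _ _ _ (fun s => F (cyl_pt s (A i p)))).
  near=> s; apply: EF => //; near: s; first exact: nbhs_pos.
  apply: (@cyl_pt_continuous_r (A i p) r U); exact: open_nbhs_nbhs.
by apply: is_derive_cyl_pt; exact: ((CF 1%N).2 ord0).1.
Unshelve. all: by end_near. Qed.

Lemma smooth_family_derivable i f r p :
  smooth_family i f -> 0 < r -> cdom (A i) p -> derivable (f^~ p) r 1.
Proof.
move=> sf r0 ip; have [U [F [oU Uy CF EF]]] := smooth_family_local sf r0 ip.
by have [] := smooth_family_is_derive r0 ip oU Uy CF EF.
Qed.

(** The radial derivative of a local smooth extension extends the radial
    derivative, since moving along the axis stays inside the cylinder. *)
Lemma smooth_family_derive i f :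
  smooth_family i f -> smooth_family i (fun r p => derive1 (f^~ p) r).
Proof.
move=> sf y [r0 [p ip yE]].
have [U [F [oU Uy CF EF]]] := smooth_family_local sf r0 ip.
rewrite yE cyl_ptK in Uy.
exists U, (fun y => 'D_(basis_vec ord0) F y); split => //.
  by move=> k; exact: ((CF k.+1).2 ord0).2.
move=> y' Uy' [r'0 [q iq y'E]]; rewrite -y'E cfunK//.
rewrite -{1}(cyl_ptK y') -y'E derive1E.
have Uq : U (cyl_pt (lsubmx y' 0 0) (A i q)) by rewrite y'E cyl_ptK.
by have [_ ->] := smooth_family_is_derive r'0 iq oU Uq CF EF.
Qed.

End SmoothFamily.

(** * Curvature of a cylinder *)

Section Cylinder.
Context {R : realType} {m : nat} {N : ptopologicalType}.
Variable A : @smooth_atlas R m N.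

Lemma chart_atP (p : N) : cdom (A (chart_at A p)) p.
Proof. by rewrite /chart_at; case: cid. Qed.

Lemma chart_image_open i :
  exists Q : set 'rV[R]_m, open Q /\
    forall x, (A i @` cdom (A i)) x <-> Q x /\ half_space m x.
Proof.
by have [Q [oQ ->]] := cimage_open (A i); exists Q.
Qed.

Lemma riemannian_metric_posdef (T : tensor2 A) i p :
  riemannian_metric T -> cdom (A i) p -> posdefmx (T i p).
Proof. by case=> _ _ Tsym Tpos ip; split; [exact: Tsym|exact: Tpos]. Qed.

(** The derivatives along the axis are two-sided as the axis is open. *)
Lemma partial_in_axis i (f : 'rV[R]_(1 + m) -> R) r p :
  0 < r -> cdom (A i) p ->
  partial_in (cylinder_dom i) ord0 f (cyl_pt r (A i p)) =
    derive1 (fun s => f (cyl_pt s (A i p))) r.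
Proof.
move=> r0 ip; rewrite /partial_in /derive1; congr (lim _).
have -> : within [set h : R | cylinder_dom i (cyl_pt r (A i p) +
    h *: basis_vec ord0)] 0^' = 0^'.
  have nearD : \forall h \near (0:R)^', cylinder_dom i (cyl_pt r (A i p) +
      h *: basis_vec ord0).
    have : \forall h \near (0:R)^', - r < h.
      by apply: cvg_within; apply: lt_nbhsr; rewrite oppr_lt0.
    apply: filterS => h rh; rewrite addrC cyl_ptD.
    by apply: cylinder_domE => //; rewrite -ltrBlDr sub0r.
  rewrite eqEsubset; split => V; last exact: cvg_within.
  by rewrite /within /= => H; apply: filterS2 nearD H => h Dh; apply.
have -> : (fun h : R => h^-1 * (f (cyl_pt r (A i p) + h *: basis_vec ord0) -
    f (cyl_pt r (A i p)))) = (fun h => h^-1 *: (f (cyl_pt (h + r) (A i p)) -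
    f (cyl_pt r (A i p)))).
  by apply/funext => h; rewrite [cyl_pt _ _ + _]addrC cyl_ptD.
by [].
Qed.

(** At a boundary point the chart image still contains a segment in each
    positive coordinate direction, so one-sided derivatives make sense. *)
Lemma cylinder_dom_approach (i : cidx A) k (y : 'rV[R]_(1 + m)) :
  cylinder_dom i y ->
  ProperFilter (within [set h : R | cylinder_dom i (y + h *: basis_vec k)] 0^').
Proof.
move=> [r0 xim]; apply: Build_ProperFilter_ex => V VF.
have [Q [oQ imE]] := chart_image_open i.
have [xQ xH] := (imE (rsubmx y)).1 xim.
suff : \forall h \near (0:R)^'+, cylinder_dom i (y + h *: basis_vec k).
  move=> H; have W : \forall h \near (0:R)^'+, 0 < h by exact: nbhs_right_gt.
  have : \forall h \near (0:R)^'+,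
      h != 0 -> cylinder_dom i (y + h *: basis_vec k) -> V h.
    by apply: cvg_within; exact: VF.
  move=> V'; near (0:R)^'+ => h; exists h.
  have h0 : 0 < h by near: h.
  have hD : cylinder_dom i (y + h *: basis_vec k) by near: h.
  have : h != 0 -> cylinder_dom i (y + h *: basis_vec k) -> V h by near: h.
  by rewrite gt_eqF//; exact.
have lc : continuous (fun h : R => y + h *: basis_vec k).
  move=> h; apply: row_mx_nbhs => j.
  have -> : (fun h : R => (y + h *: basis_vec k) 0 j) =
    (fun h => y 0 j + h * basis_vec k 0 j).
    by apply/funext => s; rewrite !mxE.
  apply: continuousD; first exact: cst_continuous.
  by apply: continuousM; [exact: cvg_id|exact: cst_continuous].
have yh0 : y + 0 *: basis_vec k = y by rewrite scale0r addr0.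
near=> h; have h0 : 0 < h by near: h; exact: nbhs_right_gt.
have bk (j : 'I_(1 + m)) : 0 <= (h *: basis_vec k) 0 j :> R.
  by rewrite mxE [basis_vec k _ _]mxE mulr_ge0 ?ler0n// ltW.
split.
  rewrite !mxE ltr_wpDr//; first by have := bk (lshift m 0); rewrite !mxE.
  by move: r0; rewrite !mxE.
apply/imE; split.
  near: h; apply: cvg_within.
  have oQ' : open [set y : 'rV[R]_(1 + m) | Q (rsubmx y)].
    apply: (@open_comp _ _ rsubmx Q) => // z _.
    apply: row_mx_nbhs => j.
    have -> : (fun s : 'rV[R]_(1 + m) => rsubmx s 0 j) =
      (fun s => s 0 (rshift 1 j)) by apply/funext => s; rewrite mxE.
    exact: coord_continuous.
  apply: (lc 0 [set y | Q (rsubmx y)]); rewrite yh0.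
  exact: open_nbhs_nbhs.
move=> j j0; rewrite mxE mxE addr_ge0//.
by have := xH j j0; rewrite mxE.
Unshelve. all: by end_near. Qed.

Lemma partial_in_cst (i : cidx A) k (f : 'rV[R]_(1 + m) -> R) c y :
  cylinder_dom i y -> (forall z, cylinder_dom i z -> f z = c) ->
  partial_in (cylinder_dom i) k f y = 0.
Proof.
move=> Dy fc; rewrite /partial_in.
have PF := cylinder_dom_approach k Dy.
apply: cvg_lim => //; apply: (@cvg_trans _ ((fun=> 0) @
  within [set h : R | cylinder_dom i (y + h *: basis_vec k)] 0^')).
  apply: near_eq_cvg; near=> h.
  rewrite !fc ?subrr ?mulr0//.
  by near: h; exact: withinT.
exact: cvg_cst.
Unshelve. all: by end_near. Qed.

Variable G : R -> tensor2 A.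
Hypothesis G_cyl : riemannian_cylinder G.

Definition radial_derivative (i : cidx A) (r : R) (p : N) : 'M[R]_m :=
  \matrix_(a, b) derive1 (fun s => G s i p a b) r.

Definition weingarten (i : cidx A) (r : R) (p : N) : 'M[R]_m :=
  2^-1 *: (invmx (G r i p) *m radial_derivative i r p).

(** The covariant form [G (r W - 1)] of the deviation from a cone: it vanishes
    exactly when [G r / r^2] is stationary. *)
Definition cone_defect (i : cidx A) (r : R) (p : N) : 'M[R]_m :=
  (r / 2) *: radial_derivative i r p - G r i p.

(** The trace of the square of [r W - 1], written with [G] and its derivative. *)
Definition sq_cone_defect (i : cidx A) (r : R) (p : N) : R :=
  \tr (invmx (G r i p) *m cone_defect i r p *m
       invmx (G r i p) *m cone_defect i r p).

Lemma cylinder_posdef i r p : 0 < r -> cdom (A i) p -> posdefmx (G r i p).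
Proof. by move=> r0; apply: riemannian_metric_posdef; exact: G_cyl.1. Qed.

Lemma cylinder_unit i r p : 0 < r -> cdom (A i) p -> G r i p \in unitmx.
Proof. by move=> r0 ip; exact: posdefmx_unit (cylinder_posdef r0 ip). Qed.

Lemma smooth_family_entry i a b : smooth_family i (fun r p => G r i p a b).
Proof.
have := G_cyl.2 i (rshift 1 a) (rshift 1 b); rewrite /smooth_family.
congr (smooth_on _ _); apply/funext => y.
by rewrite /cylinder_metric block_mxEdr.
Qed.

Lemma smooth_family_radial_derivative i a b :
  smooth_family i (fun r p => radial_derivative i r p a b).
Proof.
have -> : (fun r p => radial_derivative i r p a b) =
  (fun r p => derive1 (fun s => G s i p a b) r).
  by apply/funext => r; apply/funext => p; rewrite mxE.
exact: (smooth_family_derive (smooth_family_entry (i := i) a b)).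
Qed.

Lemma smooth_family_C1_pos i (f : R -> N -> R) p :
  smooth_family i f -> cdom (A i) p -> C1_pos (f^~ p).
Proof.
move=> sf ip r r0; split; first exact: smooth_family_derivable sf r0 ip.
apply: derivable1_continuous.
exact: (smooth_family_derivable (smooth_family_derive sf)).
Qed.

Lemma weingarten_C1_pos i p a b :
  cdom (A i) p -> C1_pos (fun s => weingarten i s p a b).
Proof.
move=> ip; have fa := function_algebra_C1_pos R.
have -> : (fun s => weingarten i s p a b) = (fun s => 2^-1 *
  (invmx (G s i p) *m radial_derivative i s p) a b).
  by apply/funext => s; rewrite mxE.
apply: (fa_mul fa); first exact: (fa_cst fa _).
apply: (fa_mulmx fa) => {}a {}b.
  apply: (fa_invmx fa) => [s s0|{}a {}b]; first exact: cylinder_unit.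
  exact: (smooth_family_C1_pos (smooth_family_entry (i := i) a b)).
exact: (smooth_family_C1_pos (smooth_family_radial_derivative (i := i) a b)).
Qed.

Lemma radial_derivative_sym i r p :
  0 < r -> cdom (A i) p ->
  (radial_derivative i r p)^T = radial_derivative i r p.
Proof.
move=> r0 ip; apply/matrixP => a b; rewrite !mxE !derive1E.
apply: near_eq_derive; near=> s.
have s0 : 0 < s by near: s; exact: nbhs_pos.
by rewrite -{1}(cylinder_posdef s0 ip).1 mxE.
Unshelve. all: by end_near. Qed.

Lemma cone_defect_sym i r p :
  0 < r -> cdom (A i) p -> (cone_defect i r p)^T = cone_defect i r p.
Proof.
move=> r0 ip; rewrite /cone_defect linearB linearZ /=.
by rewrite radial_derivative_sym// (cylinder_posdef r0 ip).1.
Qed.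

Lemma sq_cone_defect_ge0 i r p :
  0 < r -> cdom (A i) p -> 0 <= sq_cone_defect i r p.
Proof.
move=> r0 ip; apply: posdefmx_trace_ge0; first exact: cylinder_posdef.
exact: cone_defect_sym.
Qed.

Lemma sq_cone_defect_eq0 i r p :
  0 < r -> cdom (A i) p -> sq_cone_defect i r p = 0 -> cone_defect i r p = 0.
Proof.
move=> r0 ip; apply: posdefmx_trace_eq0; first exact: cylinder_posdef.
exact: cone_defect_sym.
Qed.

Lemma cylinder_metricE i r p :
  cdom (A i) p ->
  cylinder_metric G i (cyl_pt r (A i p)) = block_mx 1%:M 0 0 (G r i p).
Proof.
by move=> ip; rewrite /cylinder_metric lsub_cyl_pt rsub_cyl_pt cfunK.
Qed.

Lemma cylinder_metric0 (i : cidx A) y (l : 'I_(1 + m)) :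
  cylinder_metric G i y ord0 l = (ord0 == l)%:R.
Proof.
rewrite /cylinder_metric (_ : @ord0 m = lshift m (@ord0 0)); last exact/val_inj.
have [j ->|j ->] := split_ordP l.
  by rewrite block_mxEul mxE !ord1 !eqxx.
by rewrite block_mxEur mxE.
Qed.

(** The axial curves are geodesics. *)
Lemma christoffel00 (i : cidx A) k y :
  cylinder_dom i y ->
  christoffel (cylinder_dom i) (cylinder_metric G i) k ord0 ord0 y = 0.
Proof.
move=> Dy; rewrite /christoffel big1 ?mulr0// => l _.
have d0 j l' : partial_in (cylinder_dom i) j
    (fun z => cylinder_metric G i z ord0 l') y = 0.
  by apply: (@partial_in_cst i j _ (ord0 == l')%:R y Dy) => z _;
     exact: cylinder_metric0.
by rewrite !d0 addr0 subr0 mulr0.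
Qed.

(** Only the radial derivatives of [G] survive, as the entries of the metric
    with a radial index are constant. *)
Lemma christoffel0 i k j r p :
  0 < r -> cdom (A i) p ->
  christoffel (cylinder_dom i) (cylinder_metric G i) k ord0 j
    (cyl_pt r (A i p)) =
  (block_mx 0 0 0 (weingarten i r p) : 'M[R]_(1 + m)) k j.
Proof.
move=> r0 ip; have Dy := cylinder_domE r0 ip.
have d0 k' l : partial_in (cylinder_dom i) k'
    (fun z => cylinder_metric G i z ord0 l) (cyl_pt r (A i p)) = 0.
  by apply: (@partial_in_cst i k' _ (ord0 == l)%:R _ Dy) => z _;
     exact: cylinder_metric0.
have d1 l : partial_in (cylinder_dom i) ord0
    (fun z => cylinder_metric G i z j l) (cyl_pt r (A i p)) =
    (block_mx 0 0 0 (radial_derivative i r p) : 'M[R]_(1 + m)) l j.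
  rewrite partial_in_axis//.
  under [X in derive1 X]eq_fun do rewrite cylinder_metricE//.
  have [a ->|a ->] := split_ordP j; have [b ->|b ->] := split_ordP l.
  - under [X in derive1 X]eq_fun do rewrite block_mxEul.
    by rewrite block_mxEul [RHS]mxE derive1_cst.
  - under [X in derive1 X]eq_fun do rewrite block_mxEur.
    by rewrite block_mxEdl !mxE derive1_cst.
  - under [X in derive1 X]eq_fun do rewrite block_mxEdl.
    by rewrite block_mxEur !mxE derive1_cst.
  - under [X in derive1 X]eq_fun do rewrite block_mxEdr.
    by rewrite block_mxEdr -radial_derivative_sym// !mxE.
rewrite /christoffel; under eq_bigr do rewrite d1 !d0 addr0 subr0.
rewrite cylinder_metricE// invmx_block_diag; last first.
  by rewrite unitmxE det_ublock det1 mul1r -unitmxE cylinder_unit.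
rewrite invmx1.
transitivity ((2^-1 *: ((block_mx 1%:M 0 0 (invmx (G r i p)) : 'M[R]_(1 + m)) *m
    block_mx 0 0 0 (radial_derivative i r p))) k j); first by rewrite !mxE.
congr (_ k j); rewrite mulmx_block !(mulmx0, mul0mx, addr0, add0r).
by rewrite scale_block_mx !scaler0.
Qed.

(** The Riccati equation for the level sets of [r]: with the symbols [00] equal
    to 0, the terms left in the Ricci tensor are the radial derivative of the
    trace of the symbols [0 j] and the trace of their square. *)
Lemma ricci_rrE r p :
  0 < r ->
  let i := chart_at A p in
  ricci_rr G r p = - derive1 (fun s => mean_curvature G s p) r
    - \tr (weingarten i r p *m weingarten i r p).
Proof.
move=> r0 i; have ip : cdom (A i) p by exact: chart_atP.
have Dy := cylinder_domE r0 ip; pose W s : 'M[R]_(1 + m) :=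
  block_mx 0 0 0 (weingarten i s p).
have dW k : derivable (fun s => W s k k) r 1.
  have [a ->|a ->] := split_ordP k.
    by under eq_fun do rewrite block_mxEul mxE; exact: derivable_cst.
  under eq_fun do rewrite block_mxEdr.
  exact: (weingarten_C1_pos a a ip r0).1.
have trW s : \tr (W s) = mean_curvature G s p.
  by rewrite mxtrace_block mxtrace0 add0r mxtraceZ.
transitivity (\sum_k (- derive1 (fun s => W s k k) r -
    \sum_l W r k l * W r l k)).
  rewrite /ricci_rr -/i /ricci -/(cyl_pt r (A i p)); apply: eq_bigr => k _.
  rewrite (@partial_in_cst i k _ 0 _ Dy) => [|z]; last exact: christoffel00.
  rewrite sub0r partial_in_axis//; congr (- _ + _).
    rewrite !derive1E; apply: near_eq_derive; near=> s.
    by rewrite christoffel0//; near: s; exact: nbhs_pos.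
  rewrite -sumrN; apply: eq_bigr => l _.
  by rewrite christoffel00// mulr0 sub0r !christoffel0.
rewrite big_split /= !sumrN; congr (- _ - _).
  rewrite -(funext trW) derive1E /mxtrace.
  have -> : (fun s => \sum_k W s k k) = \sum_k (fun s => W s k k).
    by apply/funext => s; rewrite fct_sumE.
  rewrite (@derive_sum _ _ _ _ (fun k s => W s k k) r 1 dW).
  by apply: eq_bigr => k _; rewrite derive1E.
transitivity (\tr (W r *m W r)).
  by rewrite /mxtrace; apply: eq_bigr => k _; rewrite mxE.
rewrite mulmx_block !(mulmx0, mul0mx, addr0, add0r).
by rewrite mxtrace_block mxtrace0 add0r.
Unshelve. all: by end_near. Qed.

End Cylinder.

(** * The radial flux and its derivative *)

Lemma derive1_mulmx_const (R : realType) (m n : nat) (L : 'M[R]_(n, m))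
    (K : 'M[R]_(m, n)) (S : R -> 'M[R]_m) (r : R) :
  (forall a b, derivable (fun s => S s a b) r 1) -> forall a b,
  derive1 (fun s => (L *m S s *m K) a b) r =
    (L *m (\matrix_(c, d) derive1 (fun s => S s c d) r) *m K) a b.
Proof.
move=> dS a b.
have -> : (fun s => (L *m S s *m K) a b) =
    \sum_c \sum_d (L a d * K c b) *: (fun s => S s d c).
  apply/funext => s; rewrite fct_sumE mxE; apply: eq_bigr => c _.
  rewrite fct_sumE mxE mulr_suml; apply: eq_bigr => d _.
  by rewrite mulrAC.
rewrite derive1E derive_sum => [|c]; last first.
  by apply: derivable_sum => d; apply: derivableZ.
rewrite mxE; apply: eq_bigr => c _.
rewrite derive_sum => [|d]; last exact: derivableZ.
rewrite mxE mulr_suml; apply: eq_bigr => d _.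
by rewrite deriveZ// mxE derive1E mulrAC.
Qed.

Lemma pair_continuous_r (S T : topologicalType) (s : S) :
  continuous (fun t : T => (s, t)).
Proof.
move=> t V [[V1 V2] /= [nV1 nV2] sV]; apply: filterS nV2 => t' Vt'.
by apply: sV; split => //; exact: nbhs_singleton nV1.
Qed.

Lemma pair_continuous_l (S T : topologicalType) (t : T) :
  continuous (fun s : S => (s, t)).
Proof.
move=> s V [[V1 V2] /= [nV1 nV2] sV]; apply: filterS nV1 => s' Vs'.
by apply: sV; split => //; exact: nbhs_singleton nV2.
Qed.

Section Flux.
Context {R : realType} {m : nat} {N : ptopologicalType}.
Variable A : @smooth_atlas R m N.
Variable G : R -> tensor2 A.
Hypothesis G_cyl : riemannian_cylinder G.

Lemma metric_transition i j r p :
  0 < r -> cdom (A i) p -> cdom (A j) p ->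
  G r i p = (jacobian_chart i j p)^T *m G r j p *m jacobian_chart i j p.
Proof. by move=> r0 ip jp; have [_ H _ _] := G_cyl.1 r r0; exact: H. Qed.

(** Transition maps do not involve [r], so the radial derivative is again a
    tensor. *)
Lemma radial_derivative_transition i j r p :
  0 < r -> cdom (A i) p -> cdom (A j) p ->
  radial_derivative G i r p =
  (jacobian_chart i j p)^T *m radial_derivative G j r p *m jacobian_chart i j p.
Proof.
move=> r0 ip jp; apply/matrixP => a b.
rewrite -derive1_mulmx_const => [|c d]; last first.
  exact: (smooth_family_derivable (smooth_family_entry G_cyl c d)).
rewrite mxE !derive1E; apply: near_eq_derive; near=> s.
by rewrite -metric_transition//; near: s; exact: nbhs_pos.
Unshelve. all: by end_near. Qed.

Lemma mean_curvatureE i r p :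
  0 < r -> cdom (A i) p ->
  mean_curvature G r p = \tr (weingarten G i r p).
Proof.
move=> r0 ip; have jp := @chart_atP _ _ _ A p; set j := chart_at A p in jp.
rewrite mxtraceZ (metric_transition r0 ip jp).
rewrite (radial_derivative_transition r0 ip jp) mxtrace_congr//.
by rewrite -metric_transition// (cylinder_unit G_cyl).
Qed.

Lemma sq_cone_defect_chart i j r p :
  0 < r -> cdom (A i) p -> cdom (A j) p ->
  sq_cone_defect G i r p = sq_cone_defect G j r p.
Proof.
move=> r0 ip jp; rewrite /sq_cone_defect /cone_defect.
rewrite (metric_transition r0 ip jp) (radial_derivative_transition r0 ip jp).
rewrite scalemxAl scalemxAr -mulmxBl -mulmxBr mxtrace2_congr//.
by rewrite -metric_transition// (cylinder_unit G_cyl).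
Qed.

Definition flux (r : R) (p : N) : R :=
  r ^+ 2 * (warped_mean_curvature (m := m) id r - mean_curvature G r p).

Lemma fluxE r p : 0 < r -> flux r p = m%:R * r - r ^+ 2 * mean_curvature G r p.
Proof.
move=> r0; rewrite /flux /warped_mean_curvature derive1_id mulr1 mulrBr.
by congr (_ - _); field; rewrite gt_eqF.
Qed.

Lemma mean_curvature_C1_pos p : C1_pos (fun s => mean_curvature G s p).
Proof.
have fa := function_algebra_C1_pos R; have ip := @chart_atP _ _ _ A p.
apply: (fa_ext fa (f := fun s => \tr (weingarten G (chart_at A p) s p))).
  by move=> s s0; rewrite -mean_curvatureE.
by apply: (fa_trace fa) => a b; exact: weingarten_C1_pos.
Qed.

Lemma C1_pos_id : C1_pos (@id R).
Proof.
move=> r _; split; first exact: derivable_id.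
have -> : derive1 (@id R) = fun=> 1 by apply/funext => x; exact: derive1_id.
exact: cst_continuous.
Qed.

Lemma flux_C1_pos p : C1_pos (flux^~ p).
Proof.
have fa := function_algebra_C1_pos R.
apply: (fa_ext fa (f := fun s => m%:R * s +
  (-1) * ((s * s) * mean_curvature G s p))).
  by move=> s s0; rewrite fluxE// mulN1r expr2.
apply: (fa_add fa); apply: (fa_mul fa); first exact: (fa_cst fa _).
- exact: C1_pos_id.
- exact: (fa_cst fa _).
- by apply: (fa_mul fa); [apply: (fa_mul fa); exact: C1_pos_id|
    exact: mean_curvature_C1_pos].
Qed.

(** Completing the square in the Riccati equation: the derivative of the flux is
    the Ricci term plus the squared norm of [r W - 1]. *)
Lemma derive_flux r p :
  0 < r ->
  derive1 (flux^~ p) r =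
    r ^+ 2 * ricci_rr G r p + sq_cone_defect G (chart_at A p) r p.
Proof.
move=> r0; have ip := @chart_atP _ _ _ A p.
rewrite (ricci_rrE G_cyl)// /sq_cone_defect mxtrace_defect; last first.
  exact: (cylinder_unit G_cyl).
rewrite -/(weingarten _ _ _ _) -(mean_curvatureE r0 ip).
have [dH _] := mean_curvature_C1_pos p r0.
have dX : is_derive r 1 (fun s : R => s ^+ 2) (2 * r).
  apply: DeriveDef; first exact: exprn_derivable.
  by rewrite exp_derive /GRing.scale /= mulr1 expr1.
have dF := is_deriveB (is_deriveZ m%:R (is_derive_id r (1 : R)))
  (is_deriveM dX (derivableP dH)).
have -> : derive1 (flux^~ p) r = m%:R -
    (r ^+ 2 * derive1 (fun s => mean_curvature G s p) r +
     mean_curvature G r p * (2 * r)).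
  rewrite derive1E derive1E; apply: (@derive_val _ _ _ _ _ _ _ _).
  apply: is_derive_eq; last first.
    by rewrite -[X in X - _]mulr1.
  apply: near_eq_is_derive dF; near=> s.
  by rewrite fluxE//; near: s; exact: nbhs_pos.
by ring.
Unshelve. all: by end_near. Qed.

Lemma cyl_open_trace_weingarten_continuous i z :
  cyl_open i z ->
  {for z, continuous (fun z => \tr (weingarten G i z.1 z.2))}.
Proof.
have fa := function_algebra_continuous R (@open_cyl_open _ _ _ A i).
move: z; apply: (fa_trace fa) => a b.
have -> : (fun z => weingarten G i z.1 z.2 a b) = (fun z => 2^-1 *
  (invmx (G z.1 i z.2) *m radial_derivative G i z.1 z.2) a b).
  by apply/funext => z; rewrite mxE.
apply: (fa_mul fa); first exact: (fa_cst fa _).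
apply: (fa_mulmx fa) => {}a {}b.
  apply: (fa_invmx fa) => [z [z0 iz]|{}a {}b].
    exact: (cylinder_unit G_cyl).
  exact: (smooth_family_continuous (smooth_family_entry G_cyl a b)).
exact: (smooth_family_continuous
  (smooth_family_radial_derivative G_cyl a b)).
Qed.

Lemma cyl_open_sq_cone_defect_continuous i z :
  cyl_open i z ->
  {for z, continuous (fun z => sq_cone_defect G i z.1 z.2)}.
Proof.
have fa := function_algebra_continuous R (@open_cyl_open _ _ _ A i).
have CG a b :=
  smooth_family_continuous (smooth_family_entry G_cyl (i := i) a b).
have CI a b : forall z, cyl_open i z ->
    {for z, continuous (fun z => invmx (G z.1 i z.2) a b)}.
  apply: (fa_invmx fa) => [z' [z0 iz]|{}a {}b].
    exact: (cylinder_unit G_cyl).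
  exact: CG.
have CD a b : forall z, cyl_open i z ->
    {for z, continuous (fun z => cone_defect G i z.1 z.2 a b)}.
  apply: (fa_ext fa (f := fun z => z.1 / 2 *
    radial_derivative G i z.1 z.2 a b + (-1) * G z.1 i z.2 a b)).
    by move=> z' _; rewrite /cone_defect !mxE mulN1r.
  apply: (fa_add fa); apply: (fa_mul fa).
  - apply: (fa_mul fa); last exact: (fa_cst fa _).
    by move=> z' _; exact: cvg_fst.
  - exact: (smooth_family_continuous
      (smooth_family_radial_derivative G_cyl a b)).
  - exact: (fa_cst fa _).
  - exact: CG.
move: z; apply: (fa_trace fa) => a b.
exact: (fa_mulmx fa (fa_mulmx fa (fa_mulmx fa CI CD) CI) CD).
Qed.

Lemma flux_continuous r : 0 < r -> continuous (flux r).
Proof.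
move=> r0 p; have ip := @chart_atP _ _ _ A p; set i := chart_at A p in ip.
have C : {for p, continuous (fun q => m%:R * r -
    r ^+ 2 * \tr (weingarten G i r q))}.
  apply: continuousB; first exact: cst_continuous.
  apply: continuousM; first exact: cst_continuous.
  apply: (continuous_comp (f := fun q : N => (r, q))
    (g := fun z : R * N => \tr (weingarten G i z.1 z.2))).
    exact: pair_continuous_r.
  by apply: cyl_open_trace_weingarten_continuous; split.
rewrite /prop_for /continuous_at fluxE// (mean_curvatureE r0 ip).
apply: cvg_trans C; apply: near_eq_cvg.
have : nbhs p (cdom (A i)).
  by apply: open_nbhs_nbhs; split => //; exact: cdom_open.
by apply: filterS => q iq; rewrite fluxE// (mean_curvatureE r0 iq).
Qed.

Lemma sq_cone_defect_continuous_r p r :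
  0 < r ->
  {for r, continuous (fun s => sq_cone_defect G (chart_at A p) s p)}.
Proof.
move=> r0; have ip := @chart_atP _ _ _ A p.
apply: (continuous_comp (f := fun s : R => (s, p))
    (g := fun z : R * N => sq_cone_defect G (chart_at A p) z.1 z.2)).
  exact: pair_continuous_l.
by apply: cyl_open_sq_cone_defect_continuous; split.
Qed.

Lemma sq_ricci_continuous_r (p : N) (r : R) :
  0 < r -> {for r, continuous (fun s : R => s ^+ 2 * ricci_rr G s p)}.
Proof.
move=> r0; apply: (@near_continuous _ (fun s => derive1 (flux^~ p) s -
    sq_cone_defect G (chart_at A p) s p)).
  near=> s; rewrite derive_flux ?addrK//.
  by near: s; exact: nbhs_pos.
apply: continuousB; first exact: (flux_C1_pos p r0).2.
exact: sq_cone_defect_continuous_r.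
Unshelve. all: by end_near. Qed.

Lemma continuous_pos_within (f : R -> R) (a b : R) :
  0 < a -> (forall r, 0 < r -> {for r, continuous f}) ->
  {within `[a, b], continuous f}.
Proof.
move=> a0 cf; apply: continuous_in_subspaceT => r.
by rewrite inE /= in_itv /= => /andP[ar _]; apply: cf; exact: lt_le_trans ar.
Qed.

Lemma continuous_pos_integrable (f : R -> R) (a b : R) :
  0 < a -> (forall r, 0 < r -> {for r, continuous f}) ->
  lebesgue_measure.-integrable `[a, b] (EFin \o f).
Proof.
move=> a0 cf; apply: continuous_compact_integrable.
  exact: segment_compact.
exact: continuous_pos_within.
Qed.

Lemma flux_increment a b p :
  0 < a -> a < b ->
  flux b p - flux a p =
    (\int[lebesgue_measure]_(s in `[a, b]) (s ^+ 2 * ricci_rr G s p)) +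
    (\int[lebesgue_measure]_(s in `[a, b])
      sq_cone_defect G (chart_at A p) s p) :> R.
Proof.
move=> a0 ab; have b0 := lt_trans a0 ab.
have cd s (s0 : 0 < s) := flux_C1_pos p s0.
have IK := @continuous_pos_integrable _ a b a0 (@sq_ricci_continuous_r p).
have IQ := @continuous_pos_integrable _ a b a0 (@sq_cone_defect_continuous_r p).
have mab : measurable (`[a, b] : set (measurableTypeR R)).
  exact: measurable_itv.
rewrite -(RintegralD mab IK IQ).
transitivity (\int[lebesgue_measure]_(s in `[a, b]) derive1 (flux^~ p) s)%R.
  rewrite /Rintegral (@continuous_FTC2 _ _ (flux^~ p))//.
  - by apply: continuous_pos_within => // s s0; exact: (cd s s0).2.
  - split.
    + move=> s; rewrite in_itv /= => /andP[lt_as _].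
      exact: (cd s (lt_trans a0 lt_as)).1.
    + apply: cvg_at_right_filter.
      exact: (derivable1_continuous (cd a a0).1).
    + apply: cvg_at_left_filter.
      exact: (derivable1_continuous (cd b b0).1).
apply: eq_Rintegral => s; rewrite inE /= in_itv /= => /andP[as' _].
by rewrite derive_flux//; exact: lt_le_trans as'.
Qed.

(** If [r W = 1] then the components of [G r / r^2] have zero derivative. *)
Lemma cone_of_cone_defect_eq0 :
  (forall (r : R) p, 0 < r -> sq_cone_defect G (chart_at A p) r p = 0) ->
  forall (r : R) i p, 0 < r -> cdom (A i) p -> G r i p = r ^+ 2 *: G 1 i p.
Proof.
move=> Q0 r i p r0 ip; apply/matrixP => a b; rewrite mxE.
pose f s := G s i p a b * s ^- 2.
have df (s : R) : 0 < s -> is_derive s 1 f 0.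
  move=> s0; have dG : derivable (fun s => G s i p a b) s 1.
    exact: (smooth_family_derivable (smooth_family_entry G_cyl a b)).
  have : cone_defect G i s p = 0.
    apply: (sq_cone_defect_eq0 G_cyl) => //.
    by rewrite (sq_cone_defect_chart s0 ip (chart_atP A p)) Q0.
  move=> /matrixP/(_ a b); rewrite !mxE derive1E => E.
  have dX : is_derive s 1 (fun s : R => s ^- 2) (- (2 * s) / s ^+ 4).
    have sN0 : s ^+ 2 != 0 by rewrite expf_neq0// gt_eqF.
    apply: DeriveDef.
      exact: (@derivableV _ _ (fun s : R => s ^+ 2) s 1 sN0
        (@exprn_derivable _ 2 s 1)).
    rewrite (@deriveV _ _ (fun s : R => s ^+ 2) s 1 sN0
      (@exprn_derivable _ 2 s 1)).
    by rewrite exp_derive /GRing.scale /=; field; rewrite gt_eqF.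
  have [dM vM] := @is_deriveM _ _ _ _ s 1 _ _ (derivableP dG) dX.
  apply: DeriveDef; first exact: dM.
  rewrite [LHS]vM /GRing.scale /=.
  have -> : 'D_1 (fun s => G s i p a b) s = 2 / s * G s i p a b.
    apply: (@mulfI _ (s / 2)); first by rewrite mulf_neq0// ?gt_eqF ?invr_gt0.
    by move/eqP: E; rewrite subr_eq0 => /eqP ->; field; rewrite gt_eqF.
  by field; rewrite gt_eqF.
have fc (x y : R) : 0 < x -> x <= y -> f x = f y.
  move=> x0 xy; have [||c _] := @MVT_segment _ f (fun=> 0) x y xy.
  - move=> s; rewrite in_itv /= => /andP[lt_xs _].
    exact: (df s (lt_trans x0 lt_xs)).
  - apply: continuous_pos_within => // s s0; apply: derivable1_continuous.
    by have [] := df s s0.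
  - by rewrite mul0r => /eqP; rewrite subr_eq0 => /eqP ->.
have : f r = f 1.
  by have [r1|/ltW r1] := leP r 1; [exact: fc|apply/esym; exact: fc].
rewrite /f expr1n invr1 mulr1 => <-; rewrite mulrCA mulfV ?mulr1//.
by rewrite expf_neq0// gt_eqF.
Qed.

Lemma cone_defect_eq0_of_cone (S : tensor2 A) (r : R) i p :
  (forall s : R, 0 < s -> tensor2_eq (G s) (warped id S s)) ->
  0 < r -> cdom (A i) p -> cone_defect G i r p = 0.
Proof.
move=> GS r0 ip; apply/matrixP => a b; rewrite !mxE.
have -> : derive1 (fun s => G s i p a b) r = S i p a b * (2 * r).
  rewrite derive1E; transitivity ('D_1 (S i p a b *: (fun s : R => s ^+ 2)) r).
    apply: near_eq_derive; near=> s.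
    rewrite GS//; last by near: s; exact: nbhs_pos.
    by rewrite mxE mulrC.
  rewrite deriveZ; last exact: exprn_derivable.
  by rewrite exp_derive /GRing.scale /=; ring.
by rewrite GS// mxE /=; field.
Unshelve. all: by end_near. Qed.

End Flux.

(** * Riemannian measures *)

Lemma posdefmx_det_gt0 (R : realType) (m : nat) (S : 'M[R]_m) :
  posdefmx S -> 0 < \det S.
Proof.
move=> /posdefmx_orthonormal[P [Pu /(congr1 determinant)]].
rewrite !det_mulmx det_tr det1 mulrAC -expr2 => PS.
have P2 : 0 < \det P ^+ 2 by rewrite exprn_even_gt0//= -unitfE -unitmxE.
by rewrite -(pmulr_rgt0 _ P2) PS.
Qed.

(** The integral of a nonnegative function is the supremum of the integrals of
    the simple functions below it, hence monotone on arbitrary functions. *)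
Lemma ge0_le_integral_sup d (T : measurableType d) (R : realType)
    (mu : {measure set T -> \bar R}) (f g : T -> \bar R) :
  (forall x, 0 <= f x)%E -> (forall x, f x <= g x)%E ->
  (\int[mu]_x f x <= \int[mu]_x g x)%E.
Proof.
move=> f0 fg; have g0 x : (0 <= g x)%E by exact: le_trans (fg x).
rewrite !ge0_integralTE//; apply: ereal_sup_le => _ [h /= hf <-].
by exists h => //= x; exact: le_trans (fg x).
Qed.

Lemma iterated_integral_ge0 (R : realType) (m : nat) (f : 'rV[R]_m -> \bar R) :
  (forall x, 0 <= f x)%E -> (0 <= iterated_integral f)%E.
Proof.
elim: m f => [|m IH] f f0 /=; first exact: f0.
by apply: integral_ge0 => t _; apply: IH => x; exact: f0.
Qed.

Lemma le_iterated_integral (R : realType) (m : nat)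
    (f g : 'rV[R]_m -> \bar R) :
  (forall x, 0 <= f x)%E -> (forall x, f x <= g x)%E ->
  (iterated_integral f <= iterated_integral g)%E.
Proof.
elim: m f g => [|m IH] f g f0 fg /=; first exact: fg.
apply: ge0_le_integral_sup => t; first by apply: iterated_integral_ge0.
exact: IH.
Qed.

Definition cube (R : realType) (m : nat) (a : 'rV[R]_m) (d : R) :
    set 'rV[R]_m :=
  [set x | forall k, a 0 k <= x 0 k <= a 0 k + d].

(** Densities of Riemannian measures are bounded above and below by multiples of
    indicators of cubes, for which the iterated integral is explicit. *)
Lemma iterated_integral_cube (R : realType) (m : nat) (a : 'rV[R]_m)
    (d c : R) :
  0 <= d ->
  iterated_integral (fun x => (\1_(cube a d) x * c)%:E) = (c * d ^+ m)%:E.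
Proof.
move=> d0; elim: m a c => [|m IH] a c /=.
  by rewrite indicE mem_set ?mul1r ?expr0 ?mulr1//; case.
pose a0 := a 0 ord0; pose a' : 'rV[R]_m := \row_k a 0 (rshift 1 k).
have rowl t (x : 'rV[R]_m) :
    (row_mx (t%:M : 'rV_1) x : 'rV[R]_m.+1) 0 ord0 = t.
  rewrite (_ : ord0 = lshift m (ord0 : 'I_1)); last exact/val_inj.
  by rewrite [LHS](row_mxEl (t%:M : 'rV_1)) mxE eqxx mulr1n.
have rowr t (x : 'rV[R]_m) k :
    (row_mx (t%:M : 'rV_1) x : 'rV[R]_m.+1) 0 (rshift 1 k) = x 0 k.
  exact: row_mxEr.
have cubeE t x : cube a d (row_mx (t%:M : 'rV_1) x) <->
    (`[a0, a0 + d]%classic t /\ cube a' d x).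
  split=> [H|[Ht Hx] k].
    split; first by have := H ord0; rewrite rowl /= in_itv.
    by move=> k; have := H (rshift 1 k); rewrite rowr mxE.
  have [j kj|j kj] := split_ordP (k : 'I_(1 + m)).
    have -> : k = ord0 by apply/val_inj; rewrite kj /= ord1.
    by move: Ht; rewrite rowl /= in_itv.
  by rewrite kj rowr; have := Hx j; rewrite mxE.
transitivity (\int[lebesgue_measure]_(t in `[a0, (a0 + d)%R])
  (c * d ^+ m)%:E)%E.
  rewrite [RHS]integral_mkcond; apply: eq_integral => t _.
  rewrite patchE; case: ifPn => [|]; rewrite ?inE => Ht.
    rewrite -(IH a'); congr iterated_integral; apply/funext => x.
    rewrite !indicE (_ : (_ \in cube a d) = (x \in cube a' d))//.
    by apply/idP/idP; rewrite !inE cubeE; tauto.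
  transitivity (iterated_integral (fun x => (\1_(cube a' d) x * (0:R))%:E));
    last by rewrite IH mul0r.
  congr iterated_integral; apply/funext => x.
  rewrite mulr0 indicE memNset ?mul0r//.
  by move=> /cubeE[tI _]; case/negP: Ht; rewrite inE.
rewrite integral_cst//= lebesgue_measure_itv /= lte_fin.
case: ifPn => [_|].
  by rewrite -EFinB -EFinM addrAC subrr add0r exprSr mulrA.
rewrite ltrDl -leNgt => d0'; have -> : d = 0 by apply/eqP; rewrite eq_le d0 d0'.
by rewrite mule0 expr0n /= mulr0.
Qed.

Lemma open_borel_measurable (N : ptopologicalType) (V : set N) :
  open V -> measurable (V : set (borel N)).
Proof. by move=> oV; apply: sub_sigma_algebra. Qed.

Lemma continuous_borel_measurable (R : realType) (N : ptopologicalType)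
    (f : N -> R) :
  continuous f -> measurable_fun [set: borel N] (f : borel N -> R).
Proof.
move=> /continuousP cf.
apply: (measurability _ (RGenOpens.measurableE R)) => _ [_ [x [y ->]] <-].
by rewrite setTI; apply: open_borel_measurable; apply: cf; exact: interval_open.
Qed.

Lemma nbhs_open_sub (N : topologicalType) (p : N) (W : set N) :
  nbhs p W -> exists V : set N, [/\ open V, V p & V `<=` W].
Proof. by rewrite nbhsE => -[V [oV Vp] VW]; exists V. Qed.

Section RiemannianMeasure.
Context {R : realType} {m : nat} {N : ptopologicalType}.
Variable A : @smooth_atlas R m N.
Variables (T : tensor2 A) (mu : {measure set (borel N) -> \bar R}).
Hypothesis T_metric : riemannian_metric T.
Hypothesis mu_riem : riemannian_measure T mu.

Lemma metric_entry_continuous i a b p :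
  cdom (A i) p -> {for p, continuous (fun q => T i q a b)}.
Proof.
move=> ip; have [Tsm _ _ _] := T_metric.
have [U [F [oU Up CF EF]]] : exists (U : set 'rV[R]_m) (F : 'rV[R]_m -> R),
    [/\ open U, U (A i p), (forall k, Ck_on k U F) & forall y, U y ->
       (A i @` cdom (A i)) y -> F y = T i (cinv (A i) y) a b].
  by apply: Tsm; exists p.
have cA := chart_continuous ip.
have cF : {for p, continuous (fun q => F (A i q))}.
  by apply: continuous_comp => //; exact: (CF 0%N).1.
have nU : nbhs p [set q | U (A i q)] by apply: cA; exact: open_nbhs_nbhs.
have nd : nbhs p (cdom (A i)).
  by apply: open_nbhs_nbhs; split => //; exact: cdom_open.
have E q : U (A i q) -> cdom (A i) q -> F (A i q) = T i q a b.
  by move=> Uq iq; rewrite EF ?cfunK//; exists q.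
rewrite /prop_for /continuous_at -(E p Up ip); apply: cvg_trans cF.
by apply: near_eq_cvg; apply: filterS2 nU nd => q Uq iq; rewrite E.
Qed.

Lemma metric_det_continuous i p :
  cdom (A i) p -> {for p, continuous (fun q => \det (T i q))}.
Proof.
have fa := function_algebra_continuous R (@cdom_open _ _ _ (A i)).
move: p; apply: (fa_det fa) => a b p; exact: metric_entry_continuous.
Qed.

Lemma riemannian_measure_locally_finite p :
  exists V : set N, [/\ open V, V p & (mu V < +oo)%E].
Proof.
have ip := chart_atP A p; set i := chart_at A p in ip.
pose D := \det (T i p) + 1.
have nD : nbhs p [set q | \det (T i q) < D].
  have oD : nbhs (\det (T i p)) [set x | x < D].
    by apply: lt_nbhsl; rewrite ltrDl.
  exact: (metric_det_continuous ip oD).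
have nd : nbhs p (cdom (A i)).
  by apply: open_nbhs_nbhs; split => //; exact: cdom_open.
have nB : nbhs p [set q | cube (A i p - const_mx 1) 2 (A i q)].
  have nk (k : 'I_m) : \forall q \near p,
      A i p 0 k - 1 <= A i q 0 k <= A i p 0 k - 1 + 2.
    have c := continuous_entry (k := k) (chart_continuous ip).
    have n1 : nbhs (A i p 0 k) [set x | A i p 0 k - 1 < x].
      by apply: lt_nbhsr; rewrite ltrBlDr ltrDl.
    have n2 : nbhs (A i p 0 k) [set x | x < A i p 0 k - 1 + 2].
      by apply: lt_nbhsl; lra.
    have c1 : nbhs p [set q | A i p 0 k - 1 < A i q 0 k] by exact: c _ n1.
    have c2 : nbhs p [set q | A i q 0 k < A i p 0 k - 1 + 2] by exact: c _ n2.
    by apply: filterS2 c1 c2 => q /= /ltW -> /ltW ->.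
  have nK : nbhs p [set q | forall k,
      A i p 0 k - 1 <= A i q 0 k <= A i p 0 k - 1 + 2].
    exact: filter_forall.
  apply: filterS nK => q H k.
  by rewrite !mxE; exact: H.
have [V [oV Vp sV]] := nbhs_open_sub (filterI nd (filterI nD nB)).
exists V; split => //.
have Vi : V `<=` cdom (A i) by move=> q /sV[].
rewrite (mu_riem (open_borel_measurable oV) Vi).
apply: (@le_lt_trans _ _ (iterated_integral (fun x =>
  (\1_(cube (A i p - const_mx 1) 2) x * Num.sqrt D)%:E))); last first.
  by rewrite iterated_integral_cube// ltry.
apply: le_iterated_integral => x; first by rewrite lee_fin mulr_ge0.
rewrite lee_fin !indicE.
case: (boolP (x \in _)); rewrite ?inE => Vx; last first.
  by rewrite mul0r mulr_ge0.
have [q Vq qx] := Vx; have [iq [Dq Bq]] := sV q Vq.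
rewrite mem_set; last by rewrite -qx.
by rewrite !mul1r -qx cfunK// ler_wsqrtr// ltW.
Qed.

Lemma riemannian_measure_finite :
  compact [set: N] -> (mu [set: borel N] < +oo)%E.
Proof.
rewrite compact_cover => cN.
pose V p := projT1 (cid (riemannian_measure_locally_finite p)).
have VP p : [/\ open (V p), V p p & (mu (V p) < +oo)%E].
  by rewrite /V; case: cid.
have [|p _|F _ cF] := cN N setT V; first by move=> p _; have [] := VP p.
  by exists p => //; have [] := VP p.
have mV p : measurable (V p : set (borel N)).
  by apply: open_borel_measurable; have [] := VP p.
have mU (s : seq N) : measurable (\big[setU/set0]_(p <- s) V p : set (borel N)).
  exact: bigsetU_measurable.
have fin (s : seq N) :
    (mu (\big[setU/set0]_(p <- s) V p : set (borel N)) < +oo)%E.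
  elim: s => [|p s IH]; first by rewrite big_nil measure0.
  rewrite big_cons (le_lt_trans (measureU2 mu (mV p) (mU s)))//.
  rewrite lte_add_pinfty//.
  by have [] := VP p.
apply: le_lt_trans (fin (finmap.enum_fset F)).
apply: le_measure; rewrite ?inE//.
by move=> q /cF; rewrite /cover bigcup_fset.
Qed.

(** The image of a neighbourhood of [p] is relatively open in the half-space,
    and increasing coordinates does not leave the half-space; hence the cube has
    [A i p] as its lowest vertex, which also covers boundary points. *)
Lemma chart_image_cube i p (V : set N) :
  cdom (A i) p -> nbhs p V ->
  exists2 d : R, 0 < d & forall x, cube (A i p) d x ->
    exists2 q, cdom (A i) q /\ V q & A i q = x.
Proof.
move=> ip nV; have [Q [oQ imE]] := chart_image_open i.
have imp : (A i @` cdom (A i)) (A i p) by exists p.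
have [pQ pH] := (imE _).1 imp.
have nI : \forall x \near A i p, (A i @` cdom (A i)) x -> V (cinv (A i) x).
  have cV : nbhs (cinv (A i) (A i p)) V by rewrite cfunK.
  have := @cinv_continuous _ _ _ (A i) (A i p) V cV.
  by rewrite /nbhs /= -(nbhs_subspace_in imp).
have nQ : nbhs (A i p) Q by exact: open_nbhs_nbhs.
have : nbhs (A i p) ([set x | (A i @` cdom (A i)) x -> V (cinv (A i) x)] `&` Q).
  exact: filterI.
move=> /nbhs_ballP[e /= e0 eB].
exists (e / 2); first by rewrite divr_gt0.
move=> x cx; have [xI xQ] : ((A i @` cdom (A i)) x -> V (cinv (A i) x)) /\ Q x.
  apply: eB; split => // a k; rewrite !ord1 /ball /= ltr_norml.
  have /andP[] := cx k; lra.
have imx : (A i @` cdom (A i)) x.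
  apply/imE; split => // k k0; have /andP[+ _] := cx k.
  exact: le_trans (pH k k0).
have [q iq qx] := imx.
by exists q => //; split => //; rewrite -(cfunK iq) qx; exact: xI.
Qed.

Lemma riemannian_measure_gt0 p (V : set N) :
  open V -> V p -> (0 < mu (V : set (borel N)))%E.
Proof.
move=> oV Vp; have ip := chart_atP A p; set i := chart_at A p in ip.
have D0 := posdefmx_det_gt0 (riemannian_metric_posdef T_metric ip).
pose c := \det (T i p) / 2.
have c0 : 0 < c by rewrite divr_gt0.
have nD : nbhs p [set q | c < \det (T i q)].
  have oD : nbhs (\det (T i p)) [set x | c < x].
    by apply: lt_nbhsr; rewrite /c ltr_pdivrMr// ltr_pMr// ltr1n.
  exact: (metric_det_continuous ip oD).
have nd : nbhs p (cdom (A i)).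
  by apply: open_nbhs_nbhs; split => //; exact: cdom_open.
have nV : nbhs p V by exact: open_nbhs_nbhs.
have [U [oU Up sU]] := nbhs_open_sub (filterI nd (filterI nD nV)).
have Ui : U `<=` cdom (A i) by move=> q /sU[].
apply: (@lt_le_trans _ _ (mu (U : set (borel N)))); last first.
  apply: le_measure; rewrite ?inE; try exact: open_borel_measurable.
  by move=> q /sU[_ []].
have [d d0 dU] := chart_image_cube ip (open_nbhs_nbhs (conj oU Up)).
rewrite (mu_riem (open_borel_measurable oU) Ui).
apply: (@lt_le_trans _ _ (iterated_integral (fun x =>
  (\1_(cube (A i p) d) x * Num.sqrt c)%:E))).
  rewrite iterated_integral_cube ?ltW// lte_fin.
  by rewrite mulr_gt0 ?sqrtr_gt0 ?exprn_gt0.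
apply: le_iterated_integral => x; first by rewrite lee_fin mulr_ge0.
rewrite lee_fin !indicE.
case: (boolP (x \in _)); rewrite ?inE => cx; last first.
  by rewrite mul0r mulr_ge0.
have [q [iq Uq] qx] := dU x cx; have [_ [Dq _]] := sU q Uq.
rewrite mem_set; last by exists q.
by rewrite !mul1r -qx cfunK// ler_wsqrtr// ltW.
Qed.

End RiemannianMeasure.

(** * Integrated form of the Riccati equation *)

Lemma integrable_section d1 d2 (T1 : measurableType d1)
    (T2 : measurableType d2) (R : realType)
    (m1 : {sigma_finite_measure set T1 -> \bar R})
    (m2 : {sigma_finite_measure set T2 -> \bar R}) (f : T1 * T2 -> \bar R) :
  (m1 \x m2)%E.-integrable [set: T1 * T2] f ->
  m2.-integrable [set: T2] (fubini_G m1 f).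
Proof.
move=> fi; have /integrableP[fm _] := fi; apply/integrableP; split.
  exact: (measurable_fubini_G fi).
apply: le_lt_trans ((integrable21ltyP _ _ fm).1 fi).
apply: ge0_le_integral_sup => p; first exact: abse_ge0.
apply: le_abse_integral; first exact: measurableT.
exact: (measurable_fun_pair1 p fm).
Qed.

Section Mass.
Context {R : realType} {m : nat} {N : ptopologicalType}.
Variable A : @smooth_atlas R m N.
Variable Ghat : tensor2 A.
Variable mu : {sigma_finite_measure set (borel N) -> \bar R}.
Variable G : R -> tensor2 A.
Hypothesis Ncomp : compact [set: N].
Hypothesis Ghat_metric : riemannian_metric Ghat.
Hypothesis mu_riem : riemannian_measure Ghat mu.
Hypothesis G_cyl : riemannian_cylinder G.

Definition sq_ricci (z : measurableTypeR R * borel N) : R :=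
  z.1 ^+ 2 * ricci_rr G z.1 z.2.

Hypothesis Ric_int : (lebesgue_measure \x mu)%E.-integrable
  (`]0, +oo[ `*` [set: borel N]) (EFin \o sq_ricci).

Definition slab (a b : R) : set (measurableTypeR R * borel N) :=
  `[a, b] `*` [set: borel N].

Definition line_ricci (a b : R) (p : N) : R :=
  \int[lebesgue_measure]_(s in `[a, b]) (s ^+ 2 * ricci_rr G s p).

Definition line_defect (a b : R) (p : N) : R :=
  \int[lebesgue_measure]_(s in `[a, b]) sq_cone_defect G (chart_at A p) s p.

Lemma flux_integrable r :
  0 < r -> mu.-integrable [set: borel N] (EFin \o flux G r).
Proof.
move=> r0; have fc := flux_continuous G_cyl r0.
apply: measurable_bounded_integrable => //.
- exact: (riemannian_measure_finite Ghat_metric mu_riem Ncomp).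
- exact: continuous_borel_measurable.
have : compact (flux G r @` [set: N]).
  by apply: continuous_compact => //; exact: continuous_subspaceT.
move=> /compact_bounded[M [Mr H]]; exists M; split => // x Mx p _ /=.
by apply: H => //; exists p.
Qed.

Lemma measurable_slab (D : set (measurableTypeR R)) :
  measurable D -> measurable (D `*` [set: borel N]).
Proof. by move=> mD; exact: measurableX. Qed.

Lemma slab_integrable a b :
  0 < a -> (lebesgue_measure \x mu)%E.-integrable (slab a b) (EFin \o sq_ricci).
Proof.
move=> a0; apply: (integrableS _ _ _ Ric_int); try exact: measurable_slab.
move=> z [/= + _]; rewrite in_itv /= => /andP[az _]; split => //=.
by rewrite in_itv /= andbT (lt_le_trans a0 az).
Qed.

Lemma line_ricci_fubini a b :
  0 < a ->
  mu.-integrable [set: borel N] (EFin \o line_ricci a b) /\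
  (\int[mu]_p line_ricci a b p =
    \int[(lebesgue_measure \x mu)%E]_(z in slab a b) sq_ricci z)%R.
Proof.
move=> a0; have mS : measurable (slab a b) by exact: measurable_slab.
have fi := (integrable_mkcond (EFin \o sq_ricci) mS).1 (slab_integrable b a0).
have FE : fubini_G lebesgue_measure ((EFin \o sq_ricci) \_ (slab a b)) =
    EFin \o line_ricci a b.
  apply/funext => p; rewrite /fubini_G /= /line_ricci /Rintegral fineK.
    rewrite [RHS]integral_mkcond; apply: eq_integral => s _.
    rewrite !patchE; congr (if _ then _ else _).
    by apply/idP/idP; rewrite !inE; [case|split].
  apply: integrable_fin_num; first exact: measurable_itv.
  exact: (continuous_pos_integrable b a0
    (fun r => @sq_ricci_continuous_r _ _ _ _ _ G_cyl p r)).
split; first by rewrite -FE; exact: integrable_section.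
rewrite /Rintegral; congr fine; rewrite [RHS]integral_mkcond.
by rewrite -(integral21_prod_meas1 fi) FE.
Qed.

Lemma line_defectE a b p :
  0 < a -> a < b ->
  line_defect a b p = flux G b p - flux G a p - line_ricci a b p.
Proof.
by move=> a0 ab; rewrite (flux_increment G_cyl p a0 ab) addrAC subrr add0r.
Qed.

(** Integrability is read off from the pointwise identity, as a difference of
    integrable functions of [p]. *)
Lemma line_defect_integrable a b :
  0 < a -> a < b -> mu.-integrable [set: borel N] (EFin \o line_defect a b).
Proof.
move=> a0 ab; have b0 := lt_trans a0 ab.
have -> : EFin \o line_defect a b = (((EFin \o flux G b) \- (EFin \o flux G a))
    \- (EFin \o line_ricci a b))%E.
  by apply/funext => p /=; rewrite line_defectE.
apply: integrableB => //; last exact: (line_ricci_fubini b a0).1.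
by apply: integrableB => //; exact: flux_integrable.
Qed.

(** The radial integration is done first, at each point, where everything is
    continuous; Fubini's theorem then turns the Ricci term into an integral over
    the slab. *)
Lemma mass_increment a b :
  0 < a -> a < b ->
  relative_radial_mass id mu G b - relative_radial_mass id mu G a =
    (\int[(lebesgue_measure \x mu)%E]_(z in slab a b) sq_ricci z) +
    (\int[mu]_p line_defect a b p) :> R.
Proof.
move=> a0 ab; have b0 := lt_trans a0 ab.
have [Li LE] := line_ricci_fubini b a0.
have Fi := flux_integrable.
transitivity ((\int[mu]_p flux G b p) - (\int[mu]_p flux G a p))%R => //.
rewrite -LE -RintegralB ?Fi// -RintegralD//; last exact: line_defect_integrable.
by apply: eq_Rintegral => p _; rewrite (line_defectE p a0 ab) [RHS]addrC subrK.
Qed.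

Lemma line_defect_EFin a b p :
  0 < a -> (line_defect a b p)%:E =
    (\int[lebesgue_measure]_(s in `[a, b])
      (sq_cone_defect G (chart_at A p) s p)%:E)%E.
Proof.
move=> a0; rewrite /line_defect /Rintegral fineK//.
apply: integrable_fin_num; first exact: measurable_itv.
exact: (continuous_pos_integrable b a0
  (fun r => @sq_cone_defect_continuous_r _ _ _ _ _ G_cyl p r)).
Qed.

Lemma sq_cone_defect_itv_ge0 a b p s :
  0 < a -> `[a, b]%classic s -> 0 <= sq_cone_defect G (chart_at A p) s p.
Proof.
move=> a0; rewrite /= in_itv /= => /andP[ls _].
apply: sq_cone_defect_ge0 => //; last exact: chart_atP.
exact: lt_le_trans ls.
Qed.

Lemma line_defect_ge0 a b p : 0 < a -> 0 <= line_defect a b p.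
Proof.
by move=> a0; apply: Rintegral_ge0 => s; exact: sq_cone_defect_itv_ge0.
Qed.

Lemma le_line_defect a b a' b' p :
  0 < a' -> a' <= a -> b <= b' -> line_defect a b p <= line_defect a' b' p.
Proof.
move=> a'0 aa bb; have a0 := lt_le_trans a'0 aa.
rewrite -lee_fin !line_defect_EFin//; apply: ge0_subset_integral => //.
- have /integrableP[] := continuous_pos_integrable b' a'0
    (fun r => @sq_cone_defect_continuous_r _ _ _ _ _ G_cyl p r).
  by [].
- by move=> s sab; rewrite lee_fin; exact: sq_cone_defect_itv_ge0 sab.
- by apply: subset_itv; rewrite bnd_simp.
Qed.

Lemma le_total_defect a b a' b' :
  0 < a' -> a' <= a -> a < b -> b <= b' ->
  \int[mu]_p line_defect a b p <= \int[mu]_p line_defect a' b' p :> R.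
Proof.
move=> a'0 aa ab bb; apply: le_Rintegral => //.
- by apply: line_defect_integrable => //; exact: lt_le_trans aa.
- apply: line_defect_integrable => //.
  by apply: le_lt_trans aa _; exact: lt_le_trans bb.
- by move=> p _; exact: le_line_defect.
Qed.

Lemma total_defect_ge0 a b : 0 < a -> 0 <= \int[mu]_p line_defect a b p :> R.
Proof. by move=> a0; apply: Rintegral_ge0 => p _; exact: line_defect_ge0. Qed.

(** By continuity a positive value of the squared defect persists on the product
    of an interval with an open set, which has positive measure. *)
Lemma sq_cone_defect_eq0_of_total :
  (forall a b, 0 < a -> a < b -> \int[mu]_p line_defect a b p = 0 :> R) ->
  forall r p, 0 < r -> sq_cone_defect G (chart_at A p) r p = 0.
Proof.
move=> E0 r p r0; have ip := chart_atP A p; set i := chart_at A p in ip *.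
apply/eqP; rewrite eq_le (sq_cone_defect_ge0 G_cyl)// andbT leNgt.
apply/negP => Q0; pose c := sq_cone_defect G i r p / 2.
have c0 : 0 < c by rewrite divr_gt0.
have rp : cyl_open i (r, p) by split.
have nc : nbhs (sq_cone_defect G i r p) [set x | c < x].
  by apply: lt_nbhsr; rewrite /c ltr_pdivrMr// ltr_pMr// ltr1n.
have [[V1 V2] /= [nV1 nV2] sV] :=
  cyl_open_sq_cone_defect_continuous G_cyl rp nc.
have nd : nbhs p (cdom (A i)).
  by apply: open_nbhs_nbhs; split => //; exact: cdom_open.
have [V [oV Vp sV2]] := nbhs_open_sub (filterI nV2 nd).
have /nbhs_ballP[e /= e0 eV1] : nbhs r (V1 `&` [set s | 0 < s]).
  by apply: filterI => //; exact: nbhs_pos.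
pose b := r + e / 2.
have rb : r < b by rewrite ltrDl divr_gt0.
have itvV s : `[r, b]%classic s -> V1 s.
  rewrite /= in_itv /= => /andP[rs sb]; apply: (eV1 s _).1.
  rewrite /ball /= distrC ger0_norm ?subr_ge0// ltrBlDl.
  by apply: le_lt_trans sb _; rewrite ltrD2l ltr_pdivrMr// ltr_pMr// ltr1n.
have low q : V q -> c * (b - r) <= line_defect r b q.
  move=> Vq; have [V2q iq] := sV2 q Vq; rewrite -lee_fin line_defect_EFin//.
  have -> : ((c * (b - r))%:E =
      \int[lebesgue_measure]_(s in `[r, b]) c%:E)%E.
    by rewrite integral_cst//= lebesgue_measure_itv /= lte_fin rb -EFinB -EFinM.
  apply: ge0_le_integral => //.
  - by move=> s _; rewrite lee_fin ltW.
  - have /integrableP[] := continuous_pos_integrable b r0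
      (fun r => @sq_cone_defect_continuous_r _ _ _ _ _ G_cyl q r).
    by [].
  - move=> s sb; rewrite lee_fin; have s0 : 0 < s.
      by move: sb; rewrite /= in_itv /= => /andP[/(lt_le_trans r0)].
    rewrite (sq_cone_defect_chart G_cyl s0 (chart_atP A q) iq) ltW//.
    by apply: (sV (s, q)); split => //; exact: itvV.
have : (\int[mu]_p (c * (b - r) * \1_V p)%:E <=
    \int[mu]_p (line_defect r b p)%:E)%E.
  apply: ge0_le_integral_sup => q.
    by rewrite lee_fin mulr_ge0// mulr_ge0 ?subr_ge0 ?ltW.
  rewrite lee_fin indicE; case: (boolP (q \in V)); rewrite ?inE => Vq.
    by rewrite mulr1 low.
  by rewrite mulr0 line_defect_ge0.
have -> : (\int[mu]_p (line_defect r b p)%:E = 0)%E.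
  have Li := line_defect_integrable r0 rb.
  rewrite -[LHS]fineK; last first.
    by apply: integrable_fin_num; [exact: measurableT|exact: Li].
  by have := E0 r b r0 rb; rewrite /Rintegral => ->.
under eq_integral do rewrite EFinM.
have mV : measurable (V : set (borel N)) by exact: open_borel_measurable.
have cr : 0 < c * (b - r) by rewrite mulr_gt0 ?subr_gt0.
rewrite ge0_integralZl//; last 2 first.
- by apply/measurable_EFinP; exact: measurable_indic.
- by rewrite lee_fin ltW.
rewrite integral_indic// setIT leNgt mule_gt0//.
exact: (riemannian_measure_gt0 Ghat_metric mu_riem oV Vp).
Qed.

(** The shift by 2 keeps the two radii on either side of 1, hence distinct. *)
Definition radius_lo (k : nat) : R := k.+2%:R^-1.
Definition radius_hi (k : nat) : R := k.+2%:R.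

Lemma radius_lo_gt0 k : 0 < radius_lo k. Proof. by rewrite invr_gt0 ltr0n. Qed.

Lemma radius_lt k : radius_lo k < radius_hi k.
Proof.
apply: (@lt_trans _ _ 1); last by rewrite /radius_hi ltr1n.
by rewrite /radius_lo invf_lt1 ?ltr1n// ltr0n.
Qed.

Lemma radius_hi_cvg : radius_hi k @[k --> \oo] --> +oo.
Proof.
apply/cvgryPge => M; near=> k; rewrite /radius_hi.
have : M <= k%:R by near: k; exact: nbhs_infty_ger.
by move=> /le_trans; apply; rewrite ler_nat leqW.
Unshelve. all: by end_near. Qed.

Lemma radius_lo_cvg : radius_lo k @[k --> \oo] --> 0^'+.
Proof.
move=> V VF; have : radius_lo k @[k --> \oo] --> (0 : R).
  apply/(@gtr0_cvgV0 _ _ _ _ radius_hi); last exact: radius_hi_cvg.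
  by apply: nearW => k; rewrite ltr0n.
move=> /(_ _ VF) nV.
have {}nV : \forall k \near \oo, 0 < radius_lo k -> V (radius_lo k).
  exact: nV.
have : \forall k \near \oo, V (radius_lo k).
  by apply: filterS nV => k; apply; exact: radius_lo_gt0.
exact.
Qed.

Lemma radius_exhaust r : 0 < r ->
  \forall k \near \oo, radius_lo k <= r /\ r <= radius_hi k.
Proof.
move=> r0; have /cvgryPge hi := radius_hi_cvg.
apply: filterS2 (hi r) (hi r^-1) => k rk r'k; split => //.
by rewrite -[r]invrK lef_pV2// posrE ?invr_gt0// ltr0n.
Qed.

Lemma slab_cvg :
  (\int[(lebesgue_measure \x mu)%E]_(z in slab (radius_lo k) (radius_hi k))
    sq_ricci z) @[k --> \oo] -->
  (\int[(lebesgue_measure \x mu)%E]_(z in `]0%R, +oo[ `*` [set: borel N])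
    sq_ricci z)%R.
Proof.
pose D : set (measurableTypeR R * borel N) := `]0, +oo[ `*` [set: borel N].
pose S k := slab (radius_lo k) (radius_hi k).
pose f : measurableTypeR R * borel N -> \bar R := EFin \o sq_ricci.
have mD : measurable D by exact: measurable_slab.
have mS k : measurable (S k) by exact: measurable_slab.
have SD k : S k `<=` D.
  move=> z [/= + _]; rewrite in_itv /= => /andP[kz _]; split => //=.
  by rewrite in_itv /= andbT (lt_le_trans (radius_lo_gt0 k) kz).
have fm := measurable_int _ Ric_int.
have [||||_ _ C] := @dominated_convergence _ _ _ (lebesgue_measure \x mu)%E D mD
  (fun k => f \_ (S k)) f (abse \o f) _ fm.
- move=> k; apply: ((measurable_restrict f (mS k) mD).1 _).
  exact: (measurable_funS mD (@subIsetl _ D (S k)) fm).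
- apply: aeW => z Dz; apply: cvg_near_cst.
  have z0 : 0 < z.1 by move: Dz => [/=]; rewrite in_itv /= andbT.
  apply: filterS (radius_exhaust z0) => k [kz zk].
  by rewrite patchE mem_set//; split => //=; rewrite in_itv /= kz.
- exact: integrable_abse.
- apply: aeW => z k Dz; rewrite patchE; case: ifP => _ //.
  by rewrite (_ : point = 0%E)// abse0; exact: abse_ge0.
apply: fine_cvg; rewrite fineK; last exact: integrable_fin_num.
apply: cvg_trans C; apply: near_eq_cvg; apply: nearW => k.
by rewrite /= -integral_mkcondr (setIidr (@SD k)).
Qed.

Variables M0 Moo : R.
Hypothesis M0_lim : relative_radial_mass id mu G r @[r --> 0^'+] --> M0.
Hypothesis Moo_lim : relative_radial_mass id mu G r @[r --> +oo] --> Moo.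

Let I := (\int[(lebesgue_measure \x mu)%E]_(z in `]0%R, +oo[ `*` [set: borel N])
    sq_ricci z)%R.

Lemma total_defect_cvg :
  (\int[mu]_p line_defect (radius_lo k) (radius_hi k) p) @[k --> \oo] -->
    Moo - M0 - I.
Proof.
have -> : (fun k => \int[mu]_p line_defect (radius_lo k) (radius_hi k) p)%R =
  (fun k => relative_radial_mass id mu G (radius_hi k) -
    relative_radial_mass id mu G (radius_lo k) -
    \int[(lebesgue_measure \x mu)%E]_(z in slab (radius_lo k) (radius_hi k))
    sq_ricci z)%R.
  apply/funext => k; rewrite (mass_increment (radius_lo_gt0 k) (radius_lt k)).
  by rewrite addrAC subrr add0r.
apply: cvgB; last exact: slab_cvg.
apply: cvgB.
  exact: (cvg_comp _ _ radius_hi_cvg Moo_lim).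
exact: (cvg_comp _ _ radius_lo_cvg M0_lim).
Qed.

Lemma mass_inequality : I <= Moo - M0.
Proof.
rewrite -subr_ge0; apply: (cvgr_to_ge total_defect_cvg).
by apply: nearW => k; apply: total_defect_ge0; exact: radius_lo_gt0.
Qed.

Lemma mass_equality :
  Moo - M0 = I <->
  forall r p, 0 < r -> sq_cone_defect G (chart_at A p) r p = 0.
Proof.
split=> [E|Q0].
  apply: sq_cone_defect_eq0_of_total => a b a0 ab.
  apply/eqP; rewrite eq_le total_defect_ge0// andbT.
  have := total_defect_cvg; rewrite E subrr => C.
  apply: (cvgr_to_ge C); have b0 := lt_trans a0 ab.
  apply: filterS2 (radius_exhaust a0) (radius_exhaust b0) => k [ka _] [_ kb].
  exact: (le_total_defect (radius_lo_gt0 k)).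
apply/eqP; rewrite -subr_eq0; apply/eqP.
apply: (cvg_unique _ total_defect_cvg) => //.
have -> : (fun k => \int[mu]_p line_defect (radius_lo k) (radius_hi k) p)%R =
    fun=> 0.
  apply/funext => k; rewrite /Rintegral integral0_eq// => p _.
  rewrite line_defect_EFin ?radius_lo_gt0// integral0_eq// => s.
  rewrite /= in_itv /= => /andP[ks _]; rewrite Q0//.
  exact: lt_le_trans (radius_lo_gt0 k) ks.
exact: cvg_cst.
Qed.

End Mass.

(** * Rigidity *)

Lemma nbhs_ereal_pos (R : realType) (r0 : \bar R) (P : set (\bar R)) :
  (0 <= r0)%E -> nbhs r0 P -> exists2 r : R, 0 < r & P r%:E.
Proof.
case: r0 => [r|_|//]; rewrite ?lee_fin => H.
  move=> nP; have nP' : \forall x \near r^'+, P x%:E.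
    by apply: cvg_within; exact: nP.
  have rx : \forall x \near r^'+, r < x by exact: nbhs_right_gt.
  have [x [Px rx']] : exists x : R, P x%:E /\ r < x.
    by near (r^'+) => x; exists x; split; near: x.
  by exists x => //; exact: le_lt_trans rx'.
case: H => M [_ MP]; exists (`|M| + 1); first by rewrite ltr_wpDl.
by apply: MP; rewrite lte_fin (le_lt_trans (ler_norm M))// ltrDl.
Unshelve. all: by end_near. Qed.

Lemma tensor2_norm_scale (R : realType) (m : nat) (N : ptopologicalType)
    (A : @smooth_atlas R m N) (S T : tensor2 A) (c : R) (p : N) :
  c != 0 -> S (chart_at A p) p \in unitmx ->
  tensor2_norm (fun i q => c *: S i q) (fun i q => c *: T i q) p =
    tensor2_norm S T p.
Proof.
move=> c0 Su; rewrite /tensor2_norm invmxZ; last first.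
  by rewrite unitmxZ// unitfE.
set gi := invmx _; set t := T _ p.
have e (X : 'M[R]_m) : (c^-1 *: gi) *m (c *: X) = gi *m X.
  by rewrite -scalemxAl -scalemxAr scalerA mulVf// scale1r.
have tZ : (c *: t)^T = c *: t^T by exact: linearZ.
by rewrite tZ -[X in \tr X]mulmxA !e mulmxA.
Qed.

(** The norm of the difference of two cones does not depend on [r], so an
    asymptotic condition anywhere forces the two cross sections to agree. *)
Lemma cone_asymptotic (R : realType) (m : nat) (N : ptopologicalType)
    (A : @smooth_atlas R m N) (S T : tensor2 A) (G : R -> tensor2 A)
    (r0 : \bar R) :
  riemannian_metric S -> riemannian_metric T ->
  (forall r, 0 < r -> tensor2_eq (G r) (warped id T r)) ->
  (0 <= r0)%E -> asymptotic_at id S G r0 -> tensor2_eq T S.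
Proof.
move=> Sm Tm GT r0_ge0 asym.
have E p : T (chart_at A p) p = S (chart_at A p) p.
  have ip := chart_atP A p; set i := chart_at A p in ip *.
  have Spd := riemannian_metric_posdef Sm ip.
  have Tpd := riemannian_metric_posdef Tm ip.
  have small e : 0 < e -> tensor2_norm S (fun i q => T i q - S i q) p < e.
    move=> e0; have [r r_gt0 H] := nbhs_ereal_pos r0_ge0 (asym e e0).
    have := H r r_gt0 erefl p; congr (_ < _).
    rewrite -(@tensor2_norm_scale _ _ _ _ S _ (r ^+ 2)); last 2 first.
    - by rewrite expf_neq0// gt_eqF.
    - exact: posdefmx_unit.
    by rewrite /tensor2_norm -/i GT// /warped /= scalerBr.
  apply/eqP; rewrite -subr_eq0; apply/eqP.
  have Dsym : (T i p - S i p)^T = T i p - S i p.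
    by rewrite linearB /= Tpd.1 Spd.1.
  apply: (posdefmx_trace_eq0 Spd Dsym); apply/eqP.
  rewrite eq_le (posdefmx_trace_ge0 Spd Dsym) andbT leNgt; apply/negP => tr0.
  have := small (Num.sqrt (\tr (invmx (S i p) *m (T i p - S i p) *m
    invmx (S i p) *m (T i p - S i p)))).
  by rewrite sqrtr_gt0 => /(_ tr0); rewrite /tensor2_norm -/i Dsym ltxx.
move=> i p ip; have jp := chart_atP A p.
have [_ St _ _] := Sm; have [_ Tt _ _] := Tm.
by rewrite (St _ _ _ ip jp) (Tt _ _ _ ip jp) E.
Qed.

Theorem corollary5p2 (R : realType) (n : nat) (hn : (2 <= n)%N)
  (N : ptopologicalType) (A : @smooth_atlas R n.-1 N)
  (Nhaus : hausdorff_space N) (Ncomp : compact [set: N])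
  (Ghat : tensor2 A) (Ghat_metric : riemannian_metric Ghat)
  (mu : {sigma_finite_measure set (borel N) -> \bar R})
  (mu_riem : riemannian_measure Ghat mu)
  (G : R -> tensor2 A) (G_metric : riemannian_cylinder G)
  (M0 Moo : R)
  (M0_lim : relative_radial_mass id mu G r @[r --> 0^'+] --> M0)
  (Moo_lim : relative_radial_mass id mu G r @[r --> +oo] --> Moo)
  (Ric_int : (lebesgue_measure \x mu)%E.-integrable
     (`]0, +oo[ `*` [set: borel N])
     (fun z : R * borel N => (z.1 ^+ 2 * ricci_rr G z.1 z.2)%:E)) :
  let I := (\int[(lebesgue_measure \x mu)%E]_(z in `]0%R, +oo[ `*` [set: borel N])
     (z.1 ^+ 2 * ricci_rr G z.1 z.2))%R in
  [/\ I <= Moo - M0,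
      Moo - M0 = I <-> (exists Gt : tensor2 A, riemannian_metric Gt /\
        forall r : R, 0 < r -> tensor2_eq (G r) (warped id Gt r))
    & (exists r0 : \bar R, (0 <= r0)%E /\ asymptotic_at id Ghat G r0) ->
      (Moo - M0 = I <->
        forall r : R, 0 < r -> tensor2_eq (G r) (warped id Ghat r))].
Proof.
move=> I; have ineq := mass_inequality Ncomp Ghat_metric mu_riem G_metric
  Ric_int M0_lim Moo_lim.
have equality := mass_equality Ncomp Ghat_metric mu_riem G_metric
  Ric_int M0_lim Moo_lim.
have cone : Moo - M0 = I ->
    forall r : R, 0 < r -> tensor2_eq (G r) (warped id (G 1) r).
  move=> /equality.1 Q0 r r0 i p ip.
  exact: (cone_of_cone_defect_eq0 G_metric Q0).
have eq_of_cone (S : tensor2 A) :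
    (forall r : R, 0 < r -> tensor2_eq (G r) (warped id S r)) -> Moo - M0 = I.
  move=> GS; apply/equality.2 => r p r0; rewrite /sq_cone_defect.
  by rewrite (cone_defect_eq0_of_cone GS r0 (chart_atP A p)) mulmx0 mxtrace0.
have G1 := G_metric.1 1 ltr01.
split; first exact: ineq.
- split=> [/cone GE|[S [_ GS]]]; first by exists (G 1).
  exact: eq_of_cone GS.
- move=> [r0 [r0_ge0 asym]]; split=> [/cone GE|]; last exact: eq_of_cone.
  have TS := cone_asymptotic Ghat_metric G1 GE r0_ge0 asym.
  by move=> r r_gt0 i p ip; rewrite GE// /warped TS.
Qed.
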